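(* Let $\gamma\in(0,\infty)$, $a>0$, $r\in\mathbb{N}$, and let $h_2(x)=e^{-|x|^\gamma}$. Let $\psi$ be a wavelet function such that $\widehat\psi$ is real-valued, $\widehat\psi(x)=\widehat\psi(-x)$, $\mathrm{supp}\{\widehat\psi\}\subseteq[-a,a]$, $\widehat\psi\in C^{r-1}(\mathbb{R})$, $\widehat\psi(a)=\widehat\psi'(a)=\dots=\widehat\psi^{(r-1)}(a)=0$ and $\widehat\psi^{(r)}(a-)\ne0$. Then the family $\{\Psi^{j,k},\ j\ge0,\ k\in\mathbb{Z}\}$ does not satisfy the vaguelet localization property, i.e. there do not exist constants $C>0$ and $\alpha_1\in(0,1)$ such that $$|\Psi^{j,k}(t)|\le C2^{j/2}(1+|2^jt-k|)^{-1-\alpha_1}\quad\text{for all } j\ge0,\ k\in\mathbb{Z},\ t\in\mathbb{R}.$$ In particular, $\{\Psi^{j,k},\ j\ge0,\ k\in\mathbb{Z}\}$ are not vaguelets.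
   Context: Fourier transform convention: $\widehat f(x)=\int_{\mathbb{R}}e^{-ixt}f(t)\,dt$. $\|\cdot\|$ is the $L^2(\mathbb{R})$ norm. $\psi_{j,k}(t)=2^{j/2}\psi(2^jt-k)$. $\widehat\psi^{(r)}(a-)$ is the left-sided $r$-th derivative at $a$. The functions are $\Psi^{j,k}=\Psi_{\#}^{j,k}/\|\Psi_{\#}^{j,k}\|$ with $\widehat\Psi_{\#}^{j,k}(x)=\overline{h_2(x)^{-1}}\,\widehat\psi_{j,k}(x)=e^{|x|^\gamma}\widehat\psi_{j,k}(x)$. A family $\{f_{j,k}\}$ is called vaguelets if there are constants $C$ (not depending on $j,k$) and $0<\alpha_2<\alpha_1<1$ such that for all $j,k$ and all $t,t'\in\mathbb{R}$: $|f_{j,k}(t)|\le C2^{j/2}(1+|2^jt-k|)^{-1-\alpha_1}$; $\int_{\mathbb{R}}f_{j,k}(t)\,dt=0$; and $|f_{j,k}(t)-f_{j,k}(t')|\le C2^{j(1/2+\alpha_2)}|t-t'|^{\alpha_2}$. *)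

(* Defs.v *)
From HB Require Import structures.
From mathcomp Require Import all_boot all_order all_algebra.
From mathcomp Require Import complex.
From mathcomp Require Import all_classical all_reals all_analysis.
Set Implicit Arguments.
Unset Strict Implicit.
Unset Printing Implicit Defensive.
Import Order.TTheory GRing.Theory Num.Theory.
Import numFieldNormedType.Exports.
Local Open Scope classical_set_scope.
Local Open Scope ring_scope.
Local Open Scope complex_scope.

(* Functions are concrete Borel functions on the line, not classes modulo
   a.e. equality; complex integrals are taken componentwise. *)

(* [`|z|] lives in [R[i]]; this is the same modulus as an element of [R]. *)
Definition cabs (R : realType) (z : R[i]) : R := complex.Re `|z|.

Definition expi (R : realType) (theta : R) : R[i] := cos theta +i* sin theta.

Definition cintegral (R : realType) (D : set R) (f : R -> R[i]) : R[i] :=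
  (\int[lebesgue_measure]_(t in D) complex.Re (f t)) +i*
  (\int[lebesgue_measure]_(t in D) complex.Im (f t)).

Definition cmeasurable (R : realType) (f : R -> R[i]) : Prop :=
  measurable_fun [set: R] (fun t => complex.Re (f t)) /\
  measurable_fun [set: R] (fun t => complex.Im (f t)).

Definition eL2norm (R : realType) (f : R -> R[i]) : \bar R :=
  Lnorm lebesgue_measure 2%:E (fun t => (cabs (f t))%:E).

Definition L2norm (R : realType) (f : R -> R[i]) : R := fine (eL2norm f).

Definition inL2 (R : realType) (f : R -> R[i]) : Prop :=
  cmeasurable f /\ (eL2norm f < +oo)%E.

Definition L2inner (R : realType) (f g : R -> R[i]) : R[i] :=
  cintegral [set: R] (fun t => f t * (g t)^*).

(* The integral of [exp(-ixt) f(t)] over [-n, n]. *)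
Definition truncated_fourier (R : realType) (f : R -> R[i]) (n : nat) (x : R)
    : R[i] :=
  cintegral `[- n%:R, n%:R] (fun t => expi (- (x * t)) * f t).

(* [g] is a representative of the Fourier transform of [f] in the sense of
   Plancherel; for integrable [f] this means that
   [g x] is the integral of [exp(-ixt) f(t)] over the line for almost all x. *)
Definition is_fourier (R : realType) (f g : R -> R[i]) : Prop :=
  [/\ inL2 f, inL2 g &
      eL2norm (fun x => truncated_fourier f n x - g x) @[n --> \oo] --> 0%E].

(* [2^(j/2) psi (2^j t - k)] *)
Definition wavelet_atom (R : realType) (psi : R -> R[i]) (j k : int)
    : R -> R[i] :=
  fun t => (2 `^ (j%:~R / 2))%:C * psi (2 ^ j * t - k%:~R).

(* The dyadic dilates and integer translates of [psi] form a frame of L^2.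
   Orthonormal wavelets are the case [A = B = 1] together with
   [L2norm psi = 1]; Riesz and biorthogonal wavelets are covered as well.
   Orthonormality is deliberately not imposed: no orthonormal wavelet has a
   continuous compactly supported Fourier transform [g] that is real-valued and
   even. Indeed the identity [sum_(j >= 0) g (2^j x) g (2^j (x + 2 pi q)) = 0]
   for odd [q], at [x = (2m+1) pi], [q = -(2m+1)], gives [g ((2m+1) pi) = 0]
   for all m, whereas orthonormality of the integer translates makes
   [sum_m |g (x + 2 pi m)|^2] a nonzero constant. *)
Definition is_wavelet (R : realType) (psi : R -> R[i]) : Prop :=
  inL2 psi /\
  exists A B : R, 0 < A /\
    forall f : R -> R[i], inL2 f ->
      let energy := (\esum_(p in [set: int * int])
        (cabs (L2inner f (wavelet_atom psi p.1 p.2)) ^+ 2)%:E)%E in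
      ((A * L2norm f ^+ 2)%:E <= energy)%E /\
      (energy <= (B * L2norm f ^+ 2)%:E)%E.

Definition class_C (R : realType) (n : nat) (f : R -> R) : Prop :=
  (forall m x, (m < n)%N -> derivable (derive1n m f) x 1) /\
  (forall m, (m <= n)%N -> continuous (derive1n m f)).

(* [l] is the left-sided [r]-th derivative of [f] at [a]: the left derivative
   at [a] of the derivative of order [r - 1] (meaningful for [0 < r]). *)
Definition is_left_derive (R : realType) (r : nat) (f : R -> R) (a l : R)
    : Prop :=
  (derive1n r.-1 f (a + h) - derive1n r.-1 f a) / h @[h --> 0^'-] --> l.

Definition h2 (R : realType) (gamma : R) (x : R) : R := expR (- `|x| `^ gamma).

Definition L2normalize (R : realType) (f : R -> R[i]) : R -> R[i] :=
  fun t => ((L2norm f)^-1)%:C * f t.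

(* Families are indexed by all [j k : int]; only the members with [j] in [J]
   are constrained. *)
Definition localized (R : realType) (J : set int)
    (f : int -> int -> R -> R[i]) (C alpha1 : R) : Prop :=
  forall (j k : int) (t : R), J j ->
    cabs (f j k t) <=
      C * 2 `^ (j%:~R / 2) * (1 + `|2 ^ j * t - k%:~R|) `^ (- 1 - alpha1).

Definition vaguelets (R : realType) (J : set int)
    (f : int -> int -> R -> R[i]) : Prop :=
  exists C alpha1 alpha2 : R,
    [/\ [/\ 0 < alpha2, alpha2 < alpha1 & alpha1 < 1],
        localized J f C alpha1,
        (forall j k : int, J j -> cintegral [set: R] (f j k) = 0) &
        (forall (j k : int) (t t' : R), J j ->
           cabs (f j k t - f j k t') <=
             C * 2 `^ (j%:~R * (1 / 2 + alpha2)) * `|t - t'| `^ alpha2)].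

(* Main.v *)
Require Import Defs.
From HB Require Import structures.
From mathcomp Require Import all_boot all_order all_algebra.
From mathcomp Require Import complex.
From mathcomp Require Import all_classical all_reals all_analysis.
From mathcomp Require Import measurable_realfun lra ring.
Import Order.TTheory GRing.Theory Num.Theory.
Import numFieldNormedType.Exports.
Local Open Scope classical_set_scope.
Local Open Scope ring_scope.
Local Open Scope complex_scope.
Set Implicit Arguments.
Unset Strict Implicit.
Unset Printing Implicit Defensive.

(** Suppose the localization bound holds with constants C and alpha, and look at the
    functions Psi^(m, 0), m >= 0, rescaled to the unit scale: F_m (t) =
    2 ^ (- m / 2) Psi^(m, 0) (t / 2 ^ m). They have norm 1 (or vanish, a case treated
    apart) and are dominated by one
    integrable envelope C (1 + |t|) ^ (- 1 - alpha), so their transforms are bounded by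
    one constant. On the other hand the transform of F_m is a multiple of
    exp (|2 ^ m y| ^ gamma) psihat (y), which lives on [-a, a], does not vanish
    identically near a (because the left derivative of order r at a is nonzero), and
    therefore has, for large m, almost all of its L2 mass near the points a and - a.
    A bounded function cannot have a fixed amount of L2 mass on arbitrarily short
    intervals: contradiction ([no_spreading]).

    The step from norm 1 in time to a fixed amount of mass in frequency needs one half
    of Plancherel's identity, the norm of a function being at most a constant times the
    norm of its transform. It is proved for bounded integrable functions in
    [half_plancherel]: averaging the power spectrum against a Fejer kernel produces the
    quadratic form of a small triangle ([fejer_cos], [fejer_energy]), which is close to
    the squared norm by Lebesgue's differentiation theorem. It extends to transforms in
    the sense of Plancherel in [fourier_energy_ge]; the pointwise bound extends in
    [fourier_energy_le]. The two are combined, uniformly in m, in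
    [localized_tilted_energy_spread]. Exact constants are irrelevant, so
    |z + w|^2 <= 2 |z|^2 + 2 |w|^2 serves instead of Minkowski's inequality. *)

(** * Dilations of the line *)

Section scaling.
Context {R : realType}.
Local Notation mu := (@lebesgue_measure R).
Local Open Scope ereal_scope.
Implicit Types (c : R) (A D : set R).

Lemma lebesgue_measure_scale c A : (0 < c)%R -> measurable A ->
  pushforward mu ( *%R c : _ -> measurableTypeR R) A = c^-1%:E * mu A.
Proof.
move=> c0 mA.
have c0' : (0 <= c)%R by exact: ltW.
have mc : measurable_fun [set: measurableTypeR R] ( *%R c : _ -> measurableTypeR R).
  by apply: measurable_funM.
pose P : {measure set (measurableTypeR R) -> \bar R} :=
  measure_function_pushforward__canonical__measure_function_Measure mu mc.
have H : mu A = mscale (NngNum c0') P A.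
  apply: lebesgue_measure_unique => //= _ [[a b]] _ <-.
  rewrite /mscale /= /pushforward.
  have -> : ( *%R c @^-1` `]a, b] = `](c^-1 * a)%R, (c^-1 * b)%R])%classic.
    apply/seteqP; split => x /=; rewrite !in_itv/=;
      by rewrite -[(c^-1 * a)%R]mulrC ltr_pdivrMr// -[(c^-1 * b)%R]mulrC
        ler_pdivlMr// [(x * c)%R]mulrC.
  rewrite !lebesgue_measure_itv/= !lte_fin ltr_pM2l ?invr_gt0//.
  case: ifPn => // _; last by rewrite mule0.
  by rewrite -!EFinD -EFinM -mulrBr mulVKf// gt_eqF.
rewrite H /mscale/= muleA -EFinM mulVf ?mul1e//.
by rewrite gt_eqF.
Qed.

Lemma ge0_integral_scale c D (f : R -> \bar R) : (0 < c)%R -> measurable D ->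
  measurable_fun D f -> (forall x, D x -> 0 <= f x) ->
  \int[mu]_(x in ( *%R c @^-1` D)) f (c * x)%R = c^-1%:E * \int[mu]_(x in D) f x.
Proof.
move=> c0 mD mf f0.
have c0' : (0 <= c^-1)%R by rewrite invr_ge0 ltW.
rewrite -[LHS](@ge0_integral_pushforward _ _ (measurableTypeR R)
  (measurableTypeR R) _ ( *%R c) _ mu D f)//=; last first.
  by move=> y /set_mem; exact: f0.
rewrite (eq_measure_integral (mscale (NngNum c0') mu)).
  by rewrite ge0_integral_mscale.
by move=> A mA _; exact: lebesgue_measure_scale.
Qed.

(** A positive factor respects the convention +oo - oo = -oo, so integrals of
    functions that are only measurable can be rescaled through their positive and
    negative parts. *)
Lemma gt0_muleBr c (u v : \bar R) : (0 < c)%R -> 0 <= u -> 0 <= v ->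
  c%:E * u - c%:E * v = c%:E * (u - v).
Proof.
move=> c0; case: u v => [u| |] [v| |] // _ _.
- by suff: (c * u - c * v)%:E = (c * (u - v))%:E by []; rewrite mulrBr.
- by rewrite addeNy gt0_muley ?lte_fin// gt0_muleNy ?lte_fin// addeNy.
- by rewrite !gt0_muley ?lte_fin.
- by rewrite addeNy gt0_muley ?lte_fin// gt0_muleNy ?lte_fin.
Qed.

Lemma integral_scale c D (f : R -> R) : (0 < c)%R -> measurable D ->
  measurable_fun D f ->
  (\int[mu]_(x in ( *%R c @^-1` D)) f (c * x) = c^-1 * \int[mu]_(x in D) f x)%R.
Proof.
move=> c0 mD mf; rewrite /Rintegral.
have mF : measurable_fun D (EFin \o f) by exact/measurable_EFinP.
have -> : \int[mu]_(x in ( *%R c @^-1` D)) (f (c * x)%R)%:E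
    = c^-1%:E * \int[mu]_(x in D) (f x)%:E.
  rewrite integralE [in RHS]integralE.
  have -> : (fun x => (f (c * x)%R)%:E)^\+ = (fun x => (EFin \o f)^\+ (c * x)%R).
    by apply/funext => x; rewrite !funeposE.
  have -> : (fun x => (f (c * x)%R)%:E)^\- = (fun x => (EFin \o f)^\- (c * x)%R).
    by apply/funext => x; rewrite !funenegE.
  rewrite !ge0_integral_scale//; [|exact: measurable_funeneg|exact: measurable_funepos].
  by apply: gt0_muleBr; rewrite ?invr_gt0//; exact: integral_ge0.
case: (integral _ _ _) => [u| |] /=; first by [].
- by rewrite mulry gtr0_sg ?invr_gt0// mul1e/= mulr0.
- by rewrite mulrNy gtr0_sg ?invr_gt0// mul1e/= mulr0.
Qed.

End scaling.

(** * The localization envelope *)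

Section kernel.
Context {R : realType}.
Local Notation mu := (@lebesgue_measure R).

Lemma normr_sin_le (x : R) : `|sin x| <= `|x|.
Proof.
wlog x0 : x / 0 <= x => [hw|].
  have [/hw//|/ltW x0] := leP 0 x.
  by rewrite -normrN -sinN -[leRHS]normrN hw// oppr_ge0.
have [|c _] := @MVT_segment R sin cos 0 x x0.
  by apply: continuous_subspaceT; exact: continuous_sin.
rewrite sin0 !subr0 => ->; rewrite normrM -[leRHS]mul1r.
by rewrite ler_wpM2r// cos_max.
Qed.

Lemma onem_cos_le (x : R) : 1 - cos x <= x ^+ 2 / 2.
Proof.
have -> : x = (x / 2) *+ 2 by rewrite -mulr_natr divfK.
set z := x / 2; rewrite cos_mulr2n.
have : sin z ^+ 2 <= z ^+ 2.
  rewrite -real_normK ?num_real// -[leRHS]real_normK ?num_real//.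
  by rewrite lerXn2r ?nnegrE// normr_sin_le.
rewrite sin2cos2 => h.
have -> : (z *+ 2) ^+ 2 / 2 = z ^+ 2 *+ 2.
  by rewrite !mulr2n; field.
rewrite !mulr2n; lra.
Qed.

Lemma continuous_envelope (p : R) : continuous (fun x : R => (1 + `|x|) `^ p).
Proof.
move=> x; apply: (@continuous_comp _ _ _ (fun x : R => 1 + `|x|) (fun y => y `^ p)).
  by apply: cvgD; [exact: cvg_cst|exact: norm_continuous].
apply: differentiable_continuous; apply/derivable1_diffP.
by apply: derivable_powR; rewrite in_itv/= andbT ltr_pwDl.
Qed.

Lemma envelope_le1 (p x : R) : 0 <= p -> (1 + `|x|) `^ (- 1 - p) <= 1.
Proof.
move=> p0; have -> : - 1 - p = - (1 + p) by ring.
rewrite powRN invf_le1 ?powR_gt0 ?ltr_pwDl//.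
have h1 : 1 `^ (1 + p) = 1 :> R by rewrite powR1.
by rewrite -[leLHS]h1 ge0_ler_powR ?nnegrE ?addr_ge0 ?lerDl.
Qed.

Lemma powR_cvg_pinfty (p : R) : 0 < p -> (1 + x) `^ (- p) @[x --> +oo] --> (0 : R).
Proof.
move=> p0; apply/cvgr0Pnorm_le => e e0; near=> x.
have x0 : 0 < 1 + x by near: x; exists 0; split => // y y0; rewrite ltr_pwDl// ltW.
rewrite ger0_norm ?powR_ge0// powRN.
rewrite -[leRHS]invrK lef_pV2 ?posrE ?invr_gt0 ?powR_gt0//.
rewrite -[leLHS]powRr1 ?invr_ge0 ?(ltW e0)//.
rewrite -[X in _ `^ X](mulVf (lt0r_neq0 p0)) powRrM.
apply: ge0_ler_powR; rewrite ?(ltW p0) ?nnegrE ?powR_ge0 ?(ltW x0)//.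
near: x; exists ((e^-1) `^ p^-1); split; first exact: num_real.
by move=> y /ltW/le_trans; apply; rewrite lerDr.
Unshelve. all: by end_near. Qed.

Lemma integral_envelope (p : R) : 0 < p ->
  (\int[mu]_x ((1 + `|x|) `^ (- 1 - p))%:E < +oo)%E.
Proof.
move=> p0.
rewrite ge0_symfun_integralT; last 3 first.
- by move=> x; exact: powR_ge0.
- exact: continuous_envelope.
- by move=> x /=; rewrite normrN.
rewrite -set_itvcy.
have D (x : R) : 0 <= x ->
    is_derive x 1 (fun x => - p^-1 * (1 + x) `^ (- p)) ((1 + `|x|) `^ (- 1 - p)).
  move=> x0; have x1 : 0 < 1 + x by rewrite ltr_pwDl.
  have H1 : is_derive (1 + x) 1 (fun y : R => y `^ (- p)) (- p * (1 + x) `^ (- p - 1)).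
    split; first by apply: derivable_powR; rewrite in_itv/= andbT.
    by rewrite -derive1E powR_derive1// in_itv/= andbT.
  have H2 : is_derive x 1 (fun x : R => 1 + x) 1.
    by have := is_deriveD (is_derive_cst (1 : R) x 1) (is_derive_id x 1); rewrite add0r.
  have H3 := @is_derive1_comp _ (fun y : R => y `^ (- p)) (fun x : R => 1 + x) x _ _ H1 H2.
  have H4 := is_deriveZ (- p^-1) H3.
  apply: (is_derive_eq H4).
  rewrite ger0_norm// /GRing.scale/= mulr1 mulrA mulrNN mulVf ?mul1r ?gt_eqF//.
  by congr (_ `^ _); rewrite addrC.
rewrite (@ge0_continuous_FTC2y _ _ (fun x => - p^-1 * (1 + x) `^ (- p)) 0 0).
- by rewrite -EFinD -EFinM ltry.
- by move=> x _; exact: powR_ge0.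
- by apply: continuous_subspaceT; exact: continuous_envelope.
- rewrite -(mulr0 (- p^-1)); apply: cvgM; [exact: cvg_cst|exact: powR_cvg_pinfty].
- by move=> x /ltW/D[].
- have /derivable1_diffP/differentiable_continuous := @ex_derive _ _ _ _ _ _ _ (D 0 (lexx 0)).
  by move=> h; apply: cvg_at_right_filter; exact: h.
- by move=> x; rewrite in_itv/= andbT => /ltW/D h; rewrite derive1E; exact: derive_val.
Qed.

End kernel.

(** * The Fejer kernel and its cosine transform *)

Section fejer.
Context {R : realType}.
Local Notation mu := (@lebesgue_measure R).

(** The Fejer kernel without its usual normalisation. Its value at x = 0 is 0, a
    division by zero, instead of the limit d ^+ 2 / 2; a single point does not
    affect the integrals below. *)
Definition fejer (d x : R) : R := (1 - cos (d * x)) / x ^+ 2.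

Lemma fejer_ge0 d x : 0 <= fejer d x.
Proof. by rewrite divr_ge0 ?sqr_ge0// subr_ge0 cos_le1. Qed.

Lemma fejer_le d x : fejer d x <= d ^+ 2 / 2.
Proof.
rewrite /fejer; have [->|x0] := eqVneq x 0.
  by rewrite expr0n/= invr0 mulr0 divr_ge0// sqr_ge0.
rewrite ler_pdivrMr ?exprn_even_gt0//.
by rewrite mulrAC -exprMn onem_cos_le.
Qed.

Lemma fejer_le_inv d x : fejer d x <= 2 / x ^+ 2.
Proof.
rewrite ler_wpM2r ?invr_ge0 ?sqr_ge0//.
by have := cos_geN1 (d * x); lra.
Qed.

Lemma fejerN d x : fejer (- d) x = fejer d x.
Proof. by rewrite /fejer mulNr cosN. Qed.

Lemma fejer0 x : fejer 0 x = 0.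
Proof. by rewrite /fejer mul0r cos0 subrr mul0r. Qed.

Lemma fejer_scale d x : fejer d x = d ^+ 2 * fejer 1 (d * x).
Proof.
rewrite /fejer mul1r exprMn; have [->|d0] := eqVneq d 0.
  by rewrite mul0r cos0 subrr !mul0r mulr0.
by rewrite [(d ^+ 2 * x ^+ 2)^-1]invfM [RHS]mulrCA mulVKf ?expf_neq0.
Qed.

Lemma measurable_fejer d : measurable_fun [set: R] (fejer d).
Proof.
apply: measurable_funM.
  apply: measurable_funB => //.
  apply: measurableT_comp; last exact: mulrl_measurable.
  by apply: continuous_measurable_fun; exact: continuous_cos.
have -> : (fun x : R => x ^- 2) = (fun x => `|x| `^ (- 2%:R)).
  by apply/funext => x; rewrite powR_invn// real_normK// num_real.
apply: (@measurableT_comp _ _ _ _ _ _ (@powR R ^~ (- 2%:R))) => //; exact: measurable_powR.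
Qed.

(** Boundedness near 0 and the decay 2 / x ^+ 2 at infinity are merged into one
    integrable majorant. *)
Lemma fejer1_envelope x : fejer 1 x <= 8 * (1 + `|x|) `^ (- 1 - 1).
Proof.
have x0 := normr_ge0 x.
have p1 : 0 < 1 + `|x| by rewrite ltr_pwDl.
have -> : - 1 - 1 = - 2%:R :> R by rewrite -opprD.
rewrite powR_invn ?(ltW p1)//.
have [x1|x1] := leP `|x| 1.
  apply: (le_trans (fejer_le _ _)).
  rewrite ler_pdivlMr ?exprn_gt0//.
  have : (1 + `|x|) ^+ 2 <= 2 ^+ 2 by rewrite lerXn2r ?nnegrE ?(ltW p1)//; lra.
  by rewrite expr1n; lra.
apply: (le_trans (fejer_le_inv _ _)).
rewrite ler_pdivlMr ?exprn_gt0// mulrAC ler_pdivrMr; last first.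
  by rewrite exprn_even_gt0//= -normr_gt0; lra.
rewrite -(real_normK (num_real x)).
have -> : 8 = 2 * 2 ^+ 2 :> R by ring.
rewrite -mulrA ler_wpM2l// -exprMn lerXn2r ?nnegrE ?(ltW p1) ?mulr_ge0//.
lra.
Qed.

Lemma integrable_fejer1 : mu.-integrable [set: R] (EFin \o fejer 1).
Proof.
apply/integrableP; split; first by apply/measurable_EFinP; exact: measurable_fejer.
have : (8%:E * \int[mu]_x ((1 + `|x|) `^ (- 1 - 1))%:E < +oo)%E.
  have := @integral_envelope R 1 ltr01.
  have : (0 <= \int[mu]_x ((1 + `|x|) `^ (- 1 - 1))%:E)%E.
    by apply: integral_ge0 => x _; rewrite lee_fin powR_ge0.
  case: (integral _ _ _) => [r| |] //= _ _.
  by rewrite -EFinM ltry.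
apply: le_lt_trans.
have me : measurable_fun [set: R] (fun x : R => (1 + `|x|) `^ (- 1 - 1)).
  by apply: continuous_measurable_fun; exact: continuous_envelope.
have e0 (x : R) : setT x -> (0 <= ((1 + `|x|) `^ (- 1 - 1))%:E)%E.
  by move=> _; rewrite lee_fin powR_ge0.
rewrite -ge0_integralZl_EFin//; last exact/measurable_EFinP.
apply: ge0_le_integral => //.
- by apply: measurableT_comp => //; apply/measurable_EFinP; exact: measurable_fejer.
- by apply: measurable_funeM; apply/measurable_EFinP.
- by move=> x _ /=; rewrite ger0_norm ?fejer_ge0// lee_fin fejer1_envelope.
Qed.

(** This number is pi; its positivity is what makes the lower bounds on transforms
    below nontrivial. *)
Definition kappa : R := \int[mu]_x fejer 1 x.

(** On [pi / 2, pi] the cosine is nonpositive, so the kernel is at least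
    pi ^- 2 there. *)
Lemma kappa_gt0 : 0 < kappa.
Proof.
have pi2 : 0 < (pi : R) / 2 by rewrite divr_gt0// pi_gt0.
have pp := pi_gt0 R.
have pi2pi : (pi : R) / 2 <= pi by rewrite ler_pdivrMr// ler_peMr ?(ltW pp)// ler1n.
pose D : set R := `[pi / 2, pi]%classic.
have mD : measurable D by exact: measurable_itv.
have : (\int[mu]_(x in D) ((pi : R) ^- 2)%:E <= \int[mu]_x (fejer 1 x)%:E)%E.
  apply: (@le_trans _ _ (\int[mu]_(x in D) (fejer 1 x)%:E)%E).
    apply: ge0_le_integral => //.
    - by move=> x _; rewrite lee_fin invr_ge0 sqr_ge0.
    - by apply/measurable_EFinP/measurable_funTS; exact: measurable_fejer.
    - move=> x; rewrite /D /= in_itv/= => /andP[x1 x2].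
      rewrite lee_fin /fejer mul1r.
      have x0 : 0 < x by exact: lt_le_trans x1.
      have cx : cos x <= 0.
        rewrite -(cos_pihalf R); have [->//|xn] := eqVneq x (pi / 2).
        rewrite ltW// ltr_cos; first by rewrite lt_neqAle eq_sym xn.
          by rewrite in_itv/= (ltW pi2).
        by rewrite in_itv/= (ltW x0).
      rewrite -[leLHS]mul1r ler_pM ?invr_ge0 ?sqr_ge0//; first by lra.
      by rewrite lef_pV2 ?posrE ?exprn_gt0// lerXn2r ?nnegrE ?(ltW x0) ?(ltW pp).
  apply: ge0_subset_integral => //.
    by apply/measurable_EFinP; exact: measurable_fejer.
  by move=> x _; rewrite lee_fin fejer_ge0.
rewrite -(fineK (integrable_fin_num measurableT integrable_fejer1)).
rewrite (integral_cst mu mD) /D/= lebesgue_measure_itv/= lte_fin.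
have -> : pi / 2 < pi :> R by rewrite ltr_pdivrMr// ltr_pMr// ltr1n.
rewrite -EFinB -EFinM lee_fin; apply: lt_le_trans.
by rewrite mulr_gt0 ?invr_gt0 ?exprn_gt0//; lra.
Qed.

Lemma integral_fejer_pos d : 0 < d ->
  (\int[mu]_x (fejer d x)%:E = (d * kappa)%:E)%E.
Proof.
move=> d0.
have -> : (fun x => (fejer d x)%:E) = (fun x => (d ^+ 2)%:E * (fejer 1 (d * x))%:E)%E.
  by apply/funext => x; rewrite -EFinM -fejer_scale.
rewrite ge0_integralZl_EFin//; last 3 first.
  by move=> x _; rewrite lee_fin fejer_ge0.
  apply/measurable_EFinP; apply: measurableT_comp; first exact: measurable_fejer.
  exact: mulrl_measurable.
  exact: sqr_ge0.
have := @ge0_integral_scale R d setT (EFin \o fejer 1) d0 measurableT.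
rewrite preimage_setT => -> //; last 2 first.
  by apply/measurable_EFinP; exact: measurable_fejer.
  by move=> x _; rewrite lee_fin fejer_ge0.
rewrite -(fineK (integrable_fin_num measurableT integrable_fejer1)) -!EFinM.
by rewrite mulrA expr2 mulfK ?gt_eqF.
Qed.

Lemma integrable_fejer d : mu.-integrable [set: R] (EFin \o fejer d).
Proof.
wlog d0 : d / 0 < d => [hw|].
  have [d0|d0|->] := ltgtP d 0; last 1 first.
  - have -> : EFin \o fejer 0 = cst 0%E by apply/funext => x /=; rewrite fejer0.
    exact: integrable0.
  - have -> : fejer d = fejer (- d) by apply/funext => x; rewrite fejerN.
    by apply: hw; rewrite oppr_gt0.
  - exact: hw.
apply/integrableP; split; first by apply/measurable_EFinP; exact: measurable_fejer.
under eq_integral do rewrite /= ger0_norm ?fejer_ge0//.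
by rewrite integral_fejer_pos// ltry.
Qed.

Lemma integral_fejer d : \int[mu]_x fejer d x = `|d| * kappa.
Proof.
have [d0|d0|->] := ltgtP d 0.
- rewrite -normrN gtr0_norm ?oppr_gt0//.
  under eq_Rintegral do rewrite -fejerN.
  by rewrite /Rintegral integral_fejer_pos// oppr_gt0.
- by rewrite gtr0_norm// /Rintegral integral_fejer_pos.
- under eq_Rintegral do rewrite fejer0.
  by rewrite Rintegral_cst// mul0r normr0 mul0r.
Qed.

Definition tri (d u : R) : R := Num.max 0 (d - `|u|).

Lemma tri_abs d u : 0 <= d -> (`|d + u| + `|d - u|) / 2 - `|u| = tri d u.
Proof.
move=> d0; rewrite /tri maxEle subr_ge0.
case: (ger0P u) => u0; case: (ger0P (d + u)) => u1; case: (ger0P (d - u)) => u2;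
 case: ifPn; rewrite -?ltNge; lra.
Qed.

(** By the product-to-sum formulas, fejer d x * cos (x * u) is a combination of the
    kernels of widths d + u, d - u and u. As the kernel of width w has mass
    |w| * kappa, the cosine transform of fejer d is a compactly supported triangle,
    computed without an inversion theorem. *)
Lemma fejer_cos d u : 0 <= d ->
  \int[mu]_x (fejer d x * cos (x * u)) = kappa * tri d u.
Proof.
move=> d0.
have -> : (fun x => fejer d x * cos (x * u)) =
  (fun x => (2^-1 * fejer (d + u) x + 2^-1 * fejer (d - u) x) - fejer u x).
  apply/funext => x; rewrite /fejer [x * u]mulrC.
  have -> : (d + u) * x = d * x + u * x by rewrite mulrDl.
  have -> : (d - u) * x = d * x - u * x by rewrite mulrBl.
  rewrite cosD cosB.
  by move: (x ^+ 2)^-1 => i; field.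
have I e c : mu.-integrable [set: R] (EFin \o (fun x => c * fejer e x)).
  rewrite /comp; under eq_fun do rewrite EFinM.
  by apply: integrableZl => //; exact: integrable_fejer.
have IF := integrable_fejer.
have ID : mu.-integrable [set: R]
    (EFin \o (fun x => 2^-1 * fejer (d + u) x + 2^-1 * fejer (d - u) x)).
  by rewrite /comp; under eq_fun do rewrite EFinD; apply: integrableD => //; exact: I.
rewrite RintegralB// RintegralD//.
rewrite !RintegralZl//.
rewrite !integral_fejer -tri_abs//. 
by ring.
Qed.

End fejer.

(** * Interchanging integrals *)

Section swap.
Context {R : realType}.
Local Notation mu := (@lebesgue_measure R).
Local Notation mR := (measurableTypeR R).

Lemma integrableM_bounded (v g : R -> R) (C : R) :
  mu.-integrable [set: R] (EFin \o v) -> measurable_fun [set: R] g ->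
  (forall t, `|g t| <= C) -> mu.-integrable [set: R] (EFin \o (fun t => v t * g t)).
Proof.
move=> iv mg gC.
have C0 : 0 <= C by exact: le_trans (gC 0).
have mv : measurable_fun [set: R] v by move/integrableP : iv => [/measurable_EFinP].
apply: (@le_integrable _ _ _ mu _ measurableT _ (EFin \o (fun t => C * v t))).
- by apply/measurable_EFinP; exact: measurable_funM.
- move=> t _ /=; rewrite lee_fin !normrM (ger0_norm C0) mulrC.
  by rewrite ler_wpM2r.
- by rewrite /comp; under eq_fun do rewrite EFinM; exact: integrableZl.
Qed.

Lemma integrable_prodM (u v : R -> R) (h : mR * mR -> R) (C : R) :
  mu.-integrable [set: R] (EFin \o u) -> mu.-integrable [set: R] (EFin \o v) ->
  measurable_fun setT h -> (forall z, `|h z| <= C) ->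
  (mu \x mu)%E.-integrable setT (fun z => (u z.1 * (v z.2 * h z))%:E).
Proof.
move=> iu iv mh hC.
have C0 : 0 <= C by exact: le_trans (hC (0, 0)).
have mu_ : measurable_fun [set: mR] u by move/integrableP : iu => [/measurable_EFinP].
have mv_ : measurable_fun [set: mR] v by move/integrableP : iv => [/measurable_EFinP].
pose f := fun z : mR * mR => (u z.1 * (v z.2 * h z))%:E.
have mf : measurable_fun setT f.
  apply/measurable_EFinP; apply: measurable_funM.
    exact: (measurableT_comp mu_ measurable_fst).
  apply: measurable_funM => //.
  exact: (measurableT_comp mv_ measurable_snd).
apply/integrable12ltyP => //.
have iu' := integrable_abse iu; have iv' := integrable_abse iv.
pose V := fine (\int[mu]_x `|(v x)%:E|)%E.
have VE : (\int[mu]_x `|(v x)%:E| = V%:E)%E.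
  by rewrite fineK//; exact: (integrable_fin_num measurableT iv').
have V0 : 0 <= V by rewrite fine_ge0// integral_ge0.
apply: (@le_lt_trans _ _ (\int[mu]_x ((C * V)%:E * `|(u x)%:E|))%E).
  apply: ge0_le_integral => //.
  - by move=> x _; exact: integral_ge0.
  - have mabs : measurable_fun setT (abse \o f) by exact: measurableT_comp.
    have mF : measurable_fun [set: mR] (fubini_F mu (abse \o f)).
      apply: measurable_fun_fubini_tonelli_F => // z; exact: abse_ge0.
    exact: mF.
  - by apply: measurable_funeM; apply: measurableT_comp => //; exact/measurable_EFinP.
  - move=> x _.
    apply: (@le_trans _ _ (\int[mu]_y ((C * `|u x|)%:E * `|(v y)%:E|))%E).
      apply: ge0_le_integral => //.
      - apply: measurableT_comp => //.
        exact: (measurableT_comp mf (measurable_pair1 x)).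
      - by apply: measurable_funeM; apply: measurableT_comp => //; exact/measurable_EFinP.
      - move=> y _ /=; rewrite lee_fin !normrM.
        by rewrite [C * _]mulrC -mulrA ler_wpM2l// mulrC ler_wpM2r.
    rewrite ge0_integralZl_EFin//; last 2 first.
      by apply: measurableT_comp => //; exact/measurable_EFinP.
      by rewrite mulr_ge0.
    by rewrite VE -!EFinM mulrAC.
rewrite ge0_integralZl_EFin//; last 2 first.
  by apply: measurableT_comp => //; exact/measurable_EFinP.
  by rewrite mulr_ge0.
have := integrable_fin_num measurableT iu'.
by move=> /fineK => <-; rewrite -EFinM ltry.
Qed.

Lemma swap_integrals (u v : R -> R) (h : mR * mR -> R) (C : R) :
  mu.-integrable [set: R] (EFin \o u) -> mu.-integrable [set: R] (EFin \o v) ->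
  measurable_fun setT h -> (forall z, `|h z| <= C) ->
  \int[mu]_x (u x * \int[mu]_y (v y * h (x, y))) =
  \int[mu]_y (v y * \int[mu]_x (u x * h (x, y))).
Proof.
move=> iu iv mh hC; have IF := integrable_prodM iu iv mh hC.
have /(congr1 fine) := Fubini IF.
rewrite /Rintegral/=.
have h1 x : measurable_fun [set: mR] (fun y : mR => h (x, y)).
  exact: (measurableT_comp mh (measurable_pair1 x)).
have h2 y : measurable_fun [set: mR] (fun x : mR => h (x, y)).
  exact: (measurableT_comp mh (measurable_pair2 y)).
have e1 x : (\int[mu]_y (u x * (v y * h (x, y)))%:E = (u x * \int[mu]_y (v y * h (x, y)))%:E)%E.
  have I1 := integrableM_bounded iv (h1 x) (fun y => hC (x, y)).
  rewrite -RintegralZl// /Rintegral fineK//.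
  apply: integrable_fin_num => //.
  by under eq_fun do rewrite EFinM; exact: integrableZl.
have e2 y : (\int[mu]_x (u x * (v y * h (x, y)))%:E = (v y * \int[mu]_x (u x * h (x, y)))%:E)%E.
  have I2 := integrableM_bounded iu (h2 y) (fun x => hC (x, y)).
  under eq_integral do rewrite mulrCA.
  rewrite -RintegralZl// /Rintegral fineK//.
  apply: integrable_fin_num => //.
  by under eq_fun do rewrite EFinM; exact: integrableZl.
under eq_integral do rewrite e1.
by move=> ->; under eq_integral do rewrite e2.
Qed.

End swap.

(** * Cosine and sine transforms *)

Section plancherel.
Context {R : realType}.
Local Notation mu := (@lebesgue_measure R).
Local Notation mR := (measurableTypeR R).

(** The inner integral is the finite part of a difference of two integrals of
    nonnegative functions, each measurable by Tonelli. Sections of f with a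
    divergent integral are covered. *)
Lemma measurable_Rintegral_param (f : mR * mR -> R) :
  measurable_fun setT f ->
  measurable_fun [set: R] (fun x => \int[mu]_y f (x, y)).
Proof.
move=> mf.
have mF : measurable_fun setT (EFin \o f) by exact/measurable_EFinP.
have mp : measurable_fun [set: mR] (fubini_F mu ((EFin \o f)^\+)%E).
  by apply: measurable_fun_fubini_tonelli_F => //; exact: measurable_funepos.
have mn : measurable_fun [set: mR] (fubini_F mu ((EFin \o f)^\-)%E).
  by apply: measurable_fun_fubini_tonelli_F => //; exact: measurable_funeneg.
have := measurableT_comp (fine_measurable measurableT) (emeasurable_funB mp mn).
apply: eq_measurable_fun => x _ /=.
rewrite /Rintegral integralE; congr fine; congr (_ - _)%E; apply: eq_integral => y _.
  by rewrite !funeposE.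
by rewrite !funenegE.
Qed.

Definition cosT (p : R -> R) (x : R) : R := \int[mu]_t (p t * cos (x * t)).
Definition sinT (p : R -> R) (x : R) : R := \int[mu]_t (p t * sin (x * t)).

Lemma measurable_cosM (x : R) : measurable_fun [set: R] (fun t => cos (x * t)).
Proof.
apply: measurableT_comp; last exact: mulrl_measurable.
by apply: continuous_measurable_fun; exact: continuous_cos.
Qed.

Lemma measurable_sinM (x : R) : measurable_fun [set: R] (fun t => sin (x * t)).
Proof.
apply: measurableT_comp; last exact: mulrl_measurable.
by apply: continuous_measurable_fun; exact: continuous_sin.
Qed.

Lemma measurable_prod_mul : measurable_fun [set: mR * mR] (fun z : mR * mR => z.1 * z.2 : R).
Proof. by apply: measurable_funM; [exact: measurable_fst|exact: measurable_snd]. Qed.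

Lemma measurable_cosT p : measurable_fun [set: R] p -> measurable_fun [set: R] (cosT p).
Proof.
move=> mp.
apply: (measurable_Rintegral_param (f := fun z => p z.2 * cos (z.1 * z.2))).
apply: measurable_funM; first exact: (measurableT_comp mp measurable_snd).
apply: measurableT_comp; last exact: measurable_prod_mul.
by apply: continuous_measurable_fun; exact: continuous_cos.
Qed.

Lemma measurable_sinT p : measurable_fun [set: R] p -> measurable_fun [set: R] (sinT p).
Proof.
move=> mp.
apply: (measurable_Rintegral_param (f := fun z => p z.2 * sin (z.1 * z.2))).
apply: measurable_funM; first exact: (measurableT_comp mp measurable_snd).
apply: measurableT_comp; last exact: measurable_prod_mul.
by apply: continuous_measurable_fun; exact: continuous_sin.
Qed.

Lemma tri_ge0 (d u : R) : 0 <= tri d u.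
Proof. by rewrite /tri le_max lexx. Qed.

Lemma tri_le (d u : R) : 0 <= d -> tri d u <= d.
Proof. by move=> d0; rewrite /tri ge_max d0/= gerBl. Qed.

Lemma tri_norm_le (d u : R) : 0 <= d -> `|tri d u| <= d.
Proof. by move=> d0; rewrite ger0_norm ?tri_ge0 ?tri_le. Qed.

Lemma measurable_tri d (f : mR * mR -> R) : measurable_fun setT f ->
  measurable_fun setT (fun z => tri d (f z)).
Proof.
move=> mf; apply: measurable_maxr => //; apply: measurable_funB => //.
exact: measurableT_comp.
Qed.

Lemma measurable_tri_shift d s : measurable_fun [set: R] (fun t => tri d (t - s)).
Proof.
apply: measurable_maxr => //; apply: measurable_funB => //.
by apply: measurableT_comp => //; exact: measurable_funB.
Qed.

Lemma measurable_prod_sub : measurable_fun [set: mR * mR] (fun z : mR * mR => z.2 - z.1 : R).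
Proof. by apply: measurable_funB; [exact: measurable_snd|exact: measurable_fst]. Qed.

Section fixed.
Variables (p : R -> R) (ip : mu.-integrable [set: R] (EFin \o p)).

Let mp : measurable_fun [set: R] p.
Proof. by move/integrableP : ip => [/measurable_EFinP]. Qed.

Lemma integrable_cos x : mu.-integrable [set: R] (EFin \o (fun t => p t * cos (x * t))).
Proof.
by apply: (integrableM_bounded ip (measurable_cosM x)) => t; exact: cos_max.
Qed.

Lemma integrable_sin x : mu.-integrable [set: R] (EFin \o (fun t => p t * sin (x * t))).
Proof.
by apply: (integrableM_bounded ip (measurable_sinM x)) => t; exact: sin_max.
Qed.

Let V := \int[mu]_t `|p t|.

Lemma cosT_le x : `|cosT p x| <= V.
Proof.
apply: le_trans (le_normr_Rintegral measurableT (integrable_cos x)) _.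
apply: le_Rintegral => //.
- exact: (integrable_norm (integrable_cos x)).
- exact: (integrable_norm ip).
- by move=> t _; rewrite normrM ler_piMr// cos_max.
Qed.

Lemma sinT_le x : `|sinT p x| <= V.
Proof.
apply: le_trans (le_normr_Rintegral measurableT (integrable_sin x)) _.
apply: le_Rintegral => //.
- exact: (integrable_norm (integrable_sin x)).
- exact: (integrable_norm ip).
- by move=> t _; rewrite normrM ler_piMr// sin_max.
Qed.

Lemma cosT_shift x s :
  \int[mu]_t (p t * cos (x * (t - s))) = cosT p x * cos (x * s) + sinT p x * sin (x * s).
Proof.
rewrite /cosT /sinT -!RintegralZr//; [|exact: integrable_sin|exact: integrable_cos].
rewrite -RintegralD//.
- by apply: eq_Rintegral => t _; rewrite mulrBr cosB; ring.
- by rewrite /comp; under eq_fun do rewrite mulrC EFinM; apply: integrableZl => //; exact: integrable_cos.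
- by rewrite /comp; under eq_fun do rewrite mulrC EFinM; apply: integrableZl => //; exact: integrable_sin.
Qed.

Lemma integrable_tri d s : 0 <= d ->
  mu.-integrable [set: R] (EFin \o (fun t => p t * tri d (t - s))).
Proof.
move=> d0; apply: (integrableM_bounded ip (measurable_tri_shift d s) (C := d)) => t.
exact: tri_norm_le.
Qed.

Lemma integrable_conv_tri d : 0 <= d ->
  mu.-integrable [set: R] (EFin \o (fun s => p s * \int[mu]_t (p t * tri d (t - s)))).
Proof.
move=> d0; apply: (integrableM_bounded ip (C := d * V)).
  apply: (measurable_Rintegral_param (f := fun z => p z.2 * tri d (z.2 - z.1))).
  apply: measurable_funM; first exact: (measurableT_comp mp measurable_snd).
  by apply: measurable_tri; exact: measurable_prod_sub.
move=> s; apply: le_trans (le_normr_Rintegral measurableT (integrable_tri s d0)) _.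
rewrite -RintegralZl//; last exact: (integrable_norm ip).
apply: le_Rintegral => //.
- exact: (integrable_norm (integrable_tri s d0)).
- by rewrite /comp; under eq_fun do rewrite EFinM; apply: integrableZl => //; exact: (integrable_norm ip).
- by move=> t _; rewrite normrM mulrC ler_wpM2r// tri_norm_le.
Qed.

Lemma fejer_cosT d s : 0 <= d ->
  \int[mu]_x (fejer d x * (cosT p x * cos (x * s) + sinT p x * sin (x * s))) =
  kappa * \int[mu]_t (p t * tri d (t - s)).
Proof.
move=> d0.
under eq_Rintegral do rewrite -cosT_shift.
have mh : measurable_fun setT (fun z : mR * mR => cos (z.1 * (z.2 - s)) : R).
  apply: measurableT_comp; first by apply: continuous_measurable_fun; exact: continuous_cos.
  apply: measurable_funM; first exact: measurable_fst.
  by apply: measurable_funB => //; exact: measurable_snd.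
rewrite (swap_integrals (integrable_fejer d) ip mh (fun z => cos_max _)) /=.
under eq_Rintegral do rewrite fejer_cos// mulrCA.
by rewrite RintegralZl//; exact: integrable_tri.
Qed.

(** Averaging the power spectrum of p against the Fejer kernel gives a quadratic
    form in p with a triangular kernel. Fubini is used twice: at a fixed s to
    integrate out the frequency, then to recombine the transforms with the factor
    p s. *)
Lemma fejer_energy d : 0 <= d ->
  \int[mu]_x (fejer d x * (cosT p x ^+ 2 + sinT p x ^+ 2)) =
  kappa * \int[mu]_s (p s * \int[mu]_t (p t * tri d (t - s))).
Proof.
move=> d0.
have V0 : 0 <= V by apply: le_trans (cosT_le 0).
have mc := measurable_cosT mp; have ms := measurable_sinT mp.
pose h (z : mR * mR) : R := cosT p z.2 * cos (z.2 * z.1) + sinT p z.2 * sin (z.2 * z.1).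
have mz : measurable_fun [set: mR * mR] (fun z : mR * mR => z.2 * z.1 : R).
  by apply: measurable_funM; [exact: measurable_snd|exact: measurable_fst].
have mh : measurable_fun setT h.
  apply: measurable_funD; apply: measurable_funM.
  - exact: (measurableT_comp mc measurable_snd).
  - by apply: measurableT_comp mz; apply: continuous_measurable_fun; exact: continuous_cos.
  - exact: (measurableT_comp ms measurable_snd).
  - by apply: measurableT_comp mz; apply: continuous_measurable_fun; exact: continuous_sin.
have hV z : `|h z| <= V + V.
  rewrite /h (le_trans (ler_normD _ _))// lerD// normrM.
    by rewrite -[leRHS]mulr1 ler_pM// ?cos_max// cosT_le.
  by rewrite -[leRHS]mulr1 ler_pM// ?sin_max// sinT_le.
have := swap_integrals ip (integrable_fejer d) mh hV; rewrite /h/=.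
under eq_Rintegral do rewrite fejer_cosT//.
under eq_Rintegral do rewrite mulrCA.
under [in RHS]eq_Rintegral => x _.
  have -> : \int[mu]_s (p s * (cosT p x * cos (x * s) + sinT p x * sin (x * s))) =
     cosT p x ^+ 2 + sinT p x ^+ 2.
    under eq_Rintegral do rewrite mulrDr ![p _ * (_ * _)]mulrCA.
    rewrite RintegralD//.
    - rewrite !RintegralZl//; [exact: integrable_sin|exact: integrable_cos].
    - by rewrite /comp; under eq_fun do rewrite EFinM; apply: integrableZl => //; exact: integrable_cos.
    - by rewrite /comp; under eq_fun do rewrite EFinM; apply: integrableZl => //; exact: integrable_sin.
  over.
move=> <-; rewrite RintegralZl//.
exact: integrable_conv_tri.
Qed.

End fixed.
End plancherel.

(** * Lower half of Plancherel's identity *)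

Section halfplancherel.
Context {R : realType}.
Local Notation mu := (@lebesgue_measure R).
Local Notation mR := (measurableTypeR R).

Lemma integral_ball_tri (d s C : R) (g : R -> R) : 0 < d ->
  measurable_fun [set: R] g -> (forall t, 0 <= g t) -> (forall t, g t <= C) ->
  [/\ ((\int[mu]_t (g t * tri d (t - s)))%:E <= d%:E * \int[mu]_(t in ball s d) (g t)%:E)%E,
  \int[mu]_t (g t * tri d (t - s)) <= d * (C * (d *+ 2)) &
  mu.-integrable [set: R] (EFin \o (fun t => g t * tri d (t - s)))].
Proof.
move=> d0 mg g0 gC.
have C0 : 0 <= C := le_trans (g0 0) (gC 0).
have mB : measurable (ball s d : set R) by exact: measurable_ball.
have tri0 t : ~ ball s d t -> tri d (t - s) = 0.
  rewrite /ball/= => /negP; rewrite -leNgt distrC => h.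
  by rewrite /tri max_l// subr_le0.
have mG : measurable_fun [set: R] (EFin \o (fun t => g t * tri d (t - s))).
  by apply/measurable_EFinP; apply: measurable_funM => //; exact: measurable_tri_shift.
have H : (\int[mu]_t (g t * tri d (t - s))%:E <= d%:E * \int[mu]_(t in ball s d) (g t)%:E)%E.
  rewrite -ge0_integralZl_EFin//; last 3 first.
  - by move=> t _; rewrite lee_fin.
  - by apply/measurable_EFinP/measurable_funTS.
  - exact: ltW.
  rewrite [leRHS]integral_mkcond; apply: ge0_le_integral => //.
  - by move=> t _; rewrite lee_fin mulr_ge0// tri_ge0.
  - apply/(measurable_restrictT _ mB).
    apply: (@measurable_funeM _ _ _ _ (EFin \o g)).
    by apply/measurable_EFinP/measurable_funTS.
  - move=> t _; rewrite /patch; case: ifPn => [_|/negP].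
      by rewrite -EFinM lee_fin mulrC ler_wpM2r// tri_le// ltW.
    by rewrite inE => /tri0 ->; rewrite mulr0.
have F : (\int[mu]_t (g t * tri d (t - s))%:E <= (d * (C * (d *+ 2)))%:E)%E.
  apply: (le_trans H).
  rewrite EFinM lee_pmul2l//.
  have : (\int[mu]_(t in ball s d) (g t)%:E <= (C * (d *+ 2))%:E)%E.
    rewrite EFinM -(lebesgue_measure_ball s (ltW d0)).
    rewrite -(integral_cst mu mB C%:E).
    apply: ge0_le_integral => //.
    - by move=> t _; rewrite lee_fin.
    - by apply/measurable_EFinP/measurable_funTS.
    - by move=> t _; rewrite lee_fin.
  by [].
have I : mu.-integrable [set: R] (EFin \o (fun t => g t * tri d (t - s))).
  apply/integrableP; split => //.
  under eq_integral do rewrite /= ger0_norm ?mulr_ge0 ?tri_ge0//.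
  exact: le_lt_trans F (ltry _).
have E : (\int[mu]_t (g t * tri d (t - s)))%:E = (\int[mu]_t (g t * tri d (t - s))%:E)%E.
  by rewrite /Rintegral fineK//; exact: integrable_fin_num I.
by split => //; [rewrite E|rewrite -lee_fin E].
Qed.

Lemma tri_mass_ge (d s : R) : 0 < d -> d ^+ 2 / 2 <= \int[mu]_t tri d (t - s).
Proof.
move=> d0; have d0' := ltW d0.
have [_ _] := @integral_ball_tri d s 1 (cst 1) d0 (measurable_cst _) (fun=> ler01) (fun=> lexx 1).
under eq_fun do rewrite /= mul1r.
move=> I.
have d2 : 0 < d / 2 by rewrite divr_gt0.
have mB : measurable (ball s (d / 2) : set R) by exact: measurable_ball.
rewrite -lee_fin [leRHS]fineK; last exact: integrable_fin_num I.
apply: (@le_trans _ _ (\int[mu]_(t in ball s (d / 2)) (d / 2)%:E)%E).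
  rewrite (integral_cst mu mB (d/2)%:E) /= (lebesgue_measure_ball s (ltW d2)) -EFinM lee_fin.
  by rewrite mulr2n le_eqVlt; apply/orP; left; apply/eqP; field.
apply: (@le_trans _ _ (\int[mu]_(t in ball s (d / 2)) (tri d (t - s))%:E)%E).
  apply: ge0_le_integral => //.
  - by move=> t _; rewrite lee_fin ltW.
  - by apply/measurable_EFinP/measurable_funTS; exact: measurable_tri_shift.
  - move=> t; rewrite /ball/= => ht; rewrite lee_fin /tri le_max; apply/orP; right.
    rewrite distrC in ht; rewrite lerBrDr (le_trans (lerD (lexx _) (ltW ht)))//.
    by lra.
apply: ge0_subset_integral => //.
  by apply/measurable_EFinP; exact: measurable_tri_shift.
by move=> t _; rewrite lee_fin tri_ge0.
Qed.

Section fixed.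
Variables (p : R -> R) (M : R) (ip : mu.-integrable [set: R] (EFin \o p))
  (pM : forall t, `|p t| <= M).

Let mp : measurable_fun [set: R] p.
Proof. by move/integrableP : ip => [/measurable_EFinP]. Qed.

(** Weighted oscillation of p around s. After division by d ^+ 2 it is bounded by
    twice the deviated average davg p s d, hence it tends to 0 at every Lebesgue
    point s of p. *)
Definition osc d s : R := \int[mu]_t (`|p t - p s| * tri d (t - s)).

Let mosc_f s : measurable_fun [set: R] (fun t => `|p t - p s|).
Proof. by apply: measurableT_comp => //; apply: measurable_funB. Qed.

Let osc_f_le s t : `|p t - p s| <= M + M.
Proof. by rewrite (le_trans (ler_normB _ _))// lerD. Qed.

Lemma osc_ge0 d s : 0 <= osc d s.
Proof. by apply: Rintegral_ge0 => t _; rewrite mulr_ge0// tri_ge0. Qed.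

Lemma osc_le_davg d s : 0 < d ->
  ((osc d s / d ^+ 2)%:E <= 2%:E * davg p s d)%E.
Proof.
move=> d0.
have [H _ _] := integral_ball_tri s d0 (mosc_f s) (fun t => normr_ge0 _) (osc_f_le s).
rewrite /davg /iavg/= (lebesgue_measure_ball _ (ltW d0)).
rewrite mulrC EFinM.
apply: (@le_trans _ _ ((d ^- 2)%:E * (d%:E * \int[mu]_(t in ball s d) `|p t - p s|%:E))%E).
  by rewrite lee_pmul2l// lte_fin invr_gt0 exprn_gt0.
rewrite inver mulrn_eq0/= gt_eqF//.
rewrite !muleA -!EFinM.
rewrite lee_pmul// ?integral_ge0//.
  by rewrite lee_fin mulr_ge0 ?invr_ge0 ?sqr_ge0// ltW.
by rewrite lee_fin mulr2n le_eqVlt; apply/orP; left; apply/eqP; field; rewrite gt_eqF.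
Qed.

Lemma osc_le d s : 0 < d -> osc d s / d ^+ 2 <= 4 * M.
Proof.
move=> d0.
have [_ H _] := integral_ball_tri s d0 (mosc_f s) (fun t => normr_ge0 _) (osc_f_le s).
rewrite ler_pdivrMr ?exprn_gt0//; apply: (le_trans H).
by rewrite mulr2n le_eqVlt; apply/orP; left; apply/eqP; ring.
Qed.

Lemma measurable_osc d : measurable_fun [set: R] (osc d).
Proof.
apply: (measurable_Rintegral_param (f := fun z => `|p z.2 - p z.1| * tri d (z.2 - z.1))).
apply: measurable_funM; last by apply: measurable_tri; exact: measurable_prod_sub.
apply: measurableT_comp => //; apply: measurable_funB.
  exact: (measurableT_comp mp measurable_snd).
exact: (measurableT_comp mp measurable_fst).
Qed.

Lemma ae_osc_cvg : {ae mu, forall s, osc n.+1%:R^-1 s / n.+1%:R^-1 ^+ 2 @[n --> \oo] --> (0 : R)}.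
Proof.
have := lebesgue_differentiation (open_integrable_locally openT ip).
move=> [N [mN N0 sub]]; exists N; split => //; apply: (subset_trans _ sub).
apply: subsetC => s; rewrite /=  /lebesgue_pt => h.
have h2 : (2%:E * davg p s n.+1%:R^-1)%E @[n --> \oo] --> 0%E.
  rewrite -(mule0 2%:E); apply: cvgeZl => //.
  apply: (@cvg_comp _ _ _ (fun n => (n.+1%:R^-1 : R)) (davg p s) _ (0^'+)) => //.
  move=> A hA.
  have H : \oo (@harmonic R @^-1` [set x | 0 < x -> A x]) := @cvg_harmonic R _ hA.
  by apply: (filterS _ H) => n /=; apply; rewrite invr_gt0.
suff /fine_cvgP[_ //] : (osc n.+1%:R^-1 s / n.+1%:R^-1 ^+ 2)%:E @[n --> \oo] --> (0 : R)%:E.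
apply: (squeeze_cvge _ (cvg_cst 0%E) h2); near=> n.
by rewrite /= lee_fin divr_ge0 ?sqr_ge0 ?osc_ge0//= osc_le_davg.
Unshelve. all: by end_near. Qed.

Lemma osc_integral_cvg :
  (\int[mu]_s (`|p s| * (osc n.+1%:R^-1 s / n.+1%:R^-1 ^+ 2))%:E)%E @[n --> \oo] --> 0%E.
Proof.
have d0 n : 0 < (n.+1%:R^-1 : R) by rewrite invr_gt0.
rewrite -(integral0 mu [set: R]).
pose f_ n (s : R) := (`|p s| * (osc n.+1%:R^-1 s / n.+1%:R^-1 ^+ 2))%:E.
have mf n : measurable_fun [set: R] (f_ n).
  apply/measurable_EFinP; apply: measurable_funM.
    exact: measurableT_comp.
  by apply: measurable_funM => //; exact: measurable_osc.
have cvgf : {ae mu, forall s, setT s -> f_ ^~ s @ \oo --> (cst 0%E s : \bar R)}.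
  have [N [mN N0 sub]] := ae_osc_cvg; exists N; split => //; apply: (subset_trans _ sub).
  apply: subsetC => s /= h _.
  apply: cvg_EFin; first exact: nearW.
  by rewrite -(mulr0 `|p s|); apply: cvgM => //; exact: cvg_cst.
have ig : mu.-integrable [set: R] (fun s => (4 * M)%:E * `|(p s)%:E|)%E.
  by apply: integrableZl => //; exact: integrable_abse.
have dom : {ae mu, forall s n, setT s -> (`|f_ n s| <= (4 * M)%:E * `|(p s)%:E|)%E}.
  apply: aeW => s n _ /=; rewrite lee_fin ger0_norm; last first.
    by rewrite mulr_ge0// divr_ge0 ?sqr_ge0// osc_ge0.
  by rewrite mulrC ler_wpM2r// osc_le.
by have [] := @dominated_convergence _ mR R mu setT measurableT f_ (cst 0%E) _ mf
  (measurable_cst _) cvgf ig dom.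
Qed.

Lemma integrable_sqr : mu.-integrable [set: R] (EFin \o (fun s => p s ^+ 2)).
Proof.
under eq_fun do rewrite expr2.
exact: (integrableM_bounded ip mp pM).
Qed.

Lemma integrable_osc d : 0 < d ->
  mu.-integrable [set: R] (EFin \o (fun s => `|p s| * (osc d s / d ^+ 2))).
Proof.
move=> d0; apply: (integrableM_bounded (C := 4 * M)).
- exact: (integrable_norm ip).
- by apply: measurable_funM => //; exact: measurable_osc.
- by move=> s; rewrite ger0_norm ?osc_le// divr_ge0 ?sqr_ge0// osc_ge0.
Qed.

(** Write p t as p s + (p t - p s): the first term meets the mass of the triangle,
    which is at least d ^+ 2 / 2, and the second one is an oscillation. *)
Lemma conv_tri_ge d s : 0 < d ->
  p s ^+ 2 * (d ^+ 2 / 2) - `|p s| * osc d s <= p s * \int[mu]_t (p t * tri d (t - s)).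
Proof.
move=> d0.
have It : mu.-integrable [set: R] (EFin \o (fun t => tri d (t - s))).
  have [_ _] := @integral_ball_tri d s 1 (cst 1) d0 (measurable_cst _) (fun=> ler01) (fun=> lexx 1).
  by under eq_fun do rewrite /= mul1r.
have Ip := integrable_tri ip s (ltW d0).
have Id : mu.-integrable [set: R] (EFin \o (fun t => (p t - p s) * tri d (t - s))).
  have -> : EFin \o (fun t => (p t - p s) * tri d (t - s)) =
    (fun t => (p t * tri d (t - s))%:E - (p s)%:E * (tri d (t - s))%:E)%E.
    by apply/funext => t; rewrite /comp mulrBl EFinB [in LHS]EFinM.
  by apply: integrableB => //; apply: integrableZl.
have -> : \int[mu]_t (p t * tri d (t - s)) =
    p s * \int[mu]_t tri d (t - s) + \int[mu]_t ((p t - p s) * tri d (t - s)).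
  rewrite -RintegralZl// -RintegralD//.
    by apply: eq_Rintegral => t _; ring.
  by rewrite /comp; under eq_fun do rewrite EFinM; exact: integrableZl.
have H : `|\int[mu]_t ((p t - p s) * tri d (t - s))| <= osc d s.
  apply: le_trans (le_normr_Rintegral measurableT Id) _.
  rewrite le_eqVlt; apply/orP; left; apply/eqP; apply: eq_Rintegral => t _.
  by rewrite normrM [`|tri _ _|]ger0_norm ?tri_ge0.
have H2 := tri_mass_ge s d0.
rewrite mulrDr mulrA -expr2 lerD ?ler_wpM2l ?sqr_ge0//.
rewrite lerNl (le_trans (ler_norm _))// normrN normrM.
by rewrite ler_wpM2l.
Qed.

(** The kernel fejer d is at most d ^+ 2 / 2, so the integral of the power spectrum
    dominates its Fejer average; the latter is bounded below through the
    triangular form. *)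
Lemma half_plancherel_approx d : 0 < d ->
  ((kappa * \int[mu]_s (p s ^+ 2))%:E <=
   \int[mu]_x (cosT p x ^+ 2 + sinT p x ^+ 2)%:E +
   (2 * kappa)%:E * \int[mu]_s (`|p s| * (osc d s / d ^+ 2))%:E)%E.
Proof.
move=> d0.
have k0 : 0 < kappa :> R by exact: kappa_gt0.
have d2 : 0 < d ^+ 2 by rewrite exprn_gt0.
have Io := integrable_osc d0.
have I2 := integrable_sqr.
set e := \int[mu]_s (`|p s| * (osc d s / d ^+ 2)).
have -> : (\int[mu]_s (`|p s| * (osc d s / d ^+ 2))%:E = e%:E)%E.
  by rewrite fineK//; exact: integrable_fin_num Io.
have lower : \int[mu]_s (p s ^+ 2) * (d ^+ 2 / 2) - d ^+ 2 * e <=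
    \int[mu]_s (p s * \int[mu]_t (p t * tri d (t - s))).
  rewrite -RintegralZr// -RintegralZl// -RintegralB//; last 2 first.
  - by rewrite /comp; under eq_fun do rewrite mulrC EFinM; exact: integrableZl.
  - by rewrite /comp; under eq_fun do rewrite EFinM; exact: integrableZl.
  apply: le_Rintegral => //.
  - have -> : EFin \o (fun x => p x ^+ 2 * (d ^+ 2 / 2) -
                               d ^+ 2 * (`|p x| * (osc d x / d ^+ 2)))
      = (fun x => (d ^+ 2 / 2)%:E * (p x ^+ 2)%:E -
                  (d ^+ 2)%:E * (`|p x| * (osc d x / d ^+ 2))%:E)%E.
      apply/funext => x.
      by rewrite /comp EFinB [p x ^+ 2 * _]mulrC [in LHS]EFinM [in LHS]EFinM.
    by apply: integrableB => //; apply: integrableZl.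
  - exact: (integrable_conv_tri ip (ltW d0)).
  - move=> s _; apply: le_trans (conv_tri_ge s d0).
    by rewrite lerB// mulrCA -[leLHS](mulrC _ `|p s|) mulrC [d ^+ 2 * _]mulrC mulfVK// gt_eqF.
have E := fejer_energy ip (ltW d0).
set Q := (\int[mu]_x (cosT p x ^+ 2 + sinT p x ^+ 2)%:E)%E.
have mE : measurable_fun [set: R] (fun x => cosT p x ^+ 2 + sinT p x ^+ 2).
  by apply: measurable_funD; apply: measurable_funX; [exact: measurable_cosT|exact: measurable_sinT].
have upper : ((\int[mu]_x (fejer d x * (cosT p x ^+ 2 + sinT p x ^+ 2)))%:E <= (d ^+ 2 / 2)%:E * Q)%E.
  have F : mu.-integrable [set: R]
      (EFin \o (fun x => fejer d x * (cosT p x ^+ 2 + sinT p x ^+ 2))).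
    apply: (integrableM_bounded (integrable_fejer d) mE
      (C := (\int[mu]_t `|p t|) ^+ 2 + (\int[mu]_t `|p t|) ^+ 2)).
    move=> x; rewrite ger0_norm ?addr_ge0 ?sqr_ge0// lerD//.
    - rewrite -[leLHS]real_normK ?num_real// lerXn2r ?nnegrE//; last exact: cosT_le.
      exact: le_trans (cosT_le ip 0).
    - rewrite -[leLHS]real_normK ?num_real// lerXn2r ?nnegrE//; last exact: sinT_le.
      exact: le_trans (cosT_le ip 0).
  rewrite fineK; last exact: integrable_fin_num F.
  rewrite -ge0_integralZl_EFin//; last 3 first.
  - by move=> x _; rewrite lee_fin addr_ge0 ?sqr_ge0.
  - exact/measurable_EFinP.
  - by rewrite divr_ge0// ltW.
  apply: ge0_le_integral => //.
  - by move=> x _; rewrite lee_fin mulr_ge0 ?fejer_ge0// addr_ge0 ?sqr_ge0.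
  - exact: measurable_int F.
  - by apply: measurable_funeM; exact/measurable_EFinP.
  - by move=> x _; rewrite -EFinM lee_fin ler_wpM2r ?fejer_le// addr_ge0 ?sqr_ge0.
move: upper; rewrite E.
have : (0 <= Q)%E by apply: integral_ge0 => x _; rewrite lee_fin addr_ge0 ?sqr_ge0.
case: Q => [Q| |]//= Q0; last by rewrite addye// leey.
rewrite -EFinM !lee_fin => upper.
have := ler_wpM2l (ltW k0) lower => /le_trans /(_ upper) h.
rewrite -(ler_pM2l (_ : 0 < d ^+ 2 / 2)) ?divr_gt0//.
apply: le_trans (_ : (d ^+ 2 / 2) * Q + kappa * (d ^+ 2 * e) <= _).
  by rewrite -lerBlDr (le_trans _ h)// le_eqVlt; apply/orP; left; apply/eqP; ring.
by rewrite le_eqVlt; apply/orP; left; apply/eqP; field.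
Qed.

(** The lower half of Plancherel's identity, with a constant that is half of the
    optimal one: d tends to 0 in the previous estimate. *)
Lemma half_plancherel :
  ((kappa * \int[mu]_s (p s ^+ 2))%:E <=
   \int[mu]_x (cosT p x ^+ 2 + sinT p x ^+ 2)%:E)%E.
Proof.
set Q := (\int[mu]_x _)%E.
have : (0 <= Q)%E by apply: integral_ge0 => x _; rewrite lee_fin addr_ge0 ?sqr_ge0.
have H n := @half_plancherel_approx (n.+1%:R^-1) (ltac:(by rewrite invr_gt0)).
rewrite -/Q in H.
have C : (Q + (2 * kappa)%:E * \int[mu]_s (`|p s| * (osc n.+1%:R^-1 s / n.+1%:R^-1 ^+ 2))%:E)%E
    @[n --> \oo] --> Q.
  rewrite -[X in _ --> X]adde0; apply: cvgeD => //.
  - exact: fin_num_adde_defl.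
  - exact: cvg_cst.
  - by rewrite -(mule0 (2 * kappa)%:E); apply: cvgeZl => //; exact: osc_integral_cvg.
move=> _; rewrite -(cvg_lim _ C)//.
apply: lime_ge; first by apply/cvg_ex; exists Q.
by near=> n.
Unshelve. all: by end_near. Qed.

End fixed.
End halfplancherel.

(** * Energy and truncated transforms *)

Section energy.
Context {R : realType}.
Local Notation mu := (@lebesgue_measure R).
Local Notation mR := (measurableTypeR R).
Implicit Types (f g : R -> R[i]).

Lemma cabs_sqr (z : R[i]) : cabs z ^+ 2 = complex.Re z ^+ 2 + complex.Im z ^+ 2.
Proof.
case: z => x y; rewrite /cabs normc_def /= sqr_sqrtr//.
by rewrite addr_ge0 ?sqr_ge0.
Qed.

Lemma cabs_ge0 (z : R[i]) : 0 <= cabs z.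
Proof. by case: z => x y; rewrite /cabs normc_def /= sqrtr_ge0. Qed.

Lemma cabsM (z w : R[i]) : cabs (z * w) = cabs z * cabs w.
Proof. by rewrite /cabs normrM; case: z => x y; case: w => x' y'; rewrite !normc_def/= mulr0 subr0. Qed.

Lemma cabsC (x : R) : cabs x%:C = `|x|.
Proof. by rewrite /cabs normc_def /= expr0n/= addr0 sqrtr_sqr. Qed.

Lemma normr_Re_le (z : R[i]) : `|complex.Re z| <= cabs z.
Proof.
rewrite -ler_sqr ?nnegrE ?cabs_ge0// real_normK ?num_real// cabs_sqr.
by rewrite lerDl sqr_ge0.
Qed.

Lemma normr_Im_le (z : R[i]) : `|complex.Im z| <= cabs z.
Proof.
rewrite -ler_sqr ?nnegrE ?cabs_ge0// real_normK ?num_real// cabs_sqr.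
by rewrite lerDr sqr_ge0.
Qed.

Lemma cabs_le_sum (z : R[i]) : cabs z <= `|complex.Re z| + `|complex.Im z|.
Proof.
rewrite -ler_sqr ?nnegrE ?cabs_ge0 ?addr_ge0// cabs_sqr.
rewrite sqrrD !real_normK ?num_real//.
by rewrite addrAC lerDl mulrn_wge0// mulr_ge0.
Qed.

(** This replaces the triangle inequality of the L2 norm in all estimates below;
    the extra factor 2 is absorbed in constants. *)
Lemma cabs_sqrD_le (z w : R[i]) : cabs (z + w) ^+ 2 <= 2 * cabs z ^+ 2 + 2 * cabs w ^+ 2.
Proof.
rewrite !cabs_sqr; case: z => x y; case: w => x' y' /=.
have := sqr_ge0 (x - x'); have := sqr_ge0 (y - y').
by nra.
Qed.

Definition energy (D : set R) f : \bar R := (\int[mu]_(x in D) (cabs (f x) ^+ 2)%:E)%E.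

Lemma energy_ge0 D f : (0 <= energy D f)%E.
Proof. by apply: integral_ge0 => x _; rewrite lee_fin sqr_ge0. Qed.

Lemma energy_eL2norm f : energy setT f = (eL2norm f `^ 2)%E.
Proof.
rewrite /eL2norm poweR_Lnorm//; apply: eq_integral => x _.
by rewrite /= ger0_norm ?cabs_ge0// powR_mulrn ?cabs_ge0.
Qed.

Lemma measurable_cabs_sqr f : cmeasurable f -> measurable_fun [set: R] (fun x => cabs (f x) ^+ 2).
Proof.
move=> [mr mi]; under eq_fun do rewrite cabs_sqr.
by apply: measurable_funD; apply: measurable_funX.
Qed.

Lemma cmeasurableD f g : cmeasurable f -> cmeasurable g -> cmeasurable (fun x => f x + g x).
Proof.
move=> [fr fi] [gr gi]; split.
- have -> : (fun t => complex.Re (f t + g t)) = (fun t => complex.Re (f t) + complex.Re (g t)).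
    by apply/funext => t; case: (f t) (g t) => ? ? [].
  exact: measurable_funD.
- have -> : (fun t => complex.Im (f t + g t)) = (fun t => complex.Im (f t) + complex.Im (g t)).
    by apply/funext => t; case: (f t) (g t) => ? ? [].
  exact: measurable_funD.
Qed.

Lemma cmeasurableB f g : cmeasurable f -> cmeasurable g -> cmeasurable (fun x => f x - g x).
Proof.
move=> [fr fi] [gr gi]; split.
- have -> : (fun t => complex.Re (f t - g t)) = (fun t => complex.Re (f t) - complex.Re (g t)).
    by apply/funext => t; case: (f t) (g t) => ? ? [].
  exact: measurable_funB.
- have -> : (fun t => complex.Im (f t - g t)) = (fun t => complex.Im (f t) - complex.Im (g t)).
    by apply/funext => t; case: (f t) (g t) => ? ? [].
  exact: measurable_funB.
Qed.

Lemma energyD_le (D : set R) f g : measurable D -> cmeasurable f -> cmeasurable g ->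
  (energy D (fun x => f x + g x)%R <= 2%:E * energy D f + 2%:E * energy D g)%E.
Proof.
move=> mD mf mg.
have m1 h : cmeasurable h -> measurable_fun D (fun x => (cabs (h x) ^+ 2)%:E).
  by move=> mh; apply/measurable_EFinP/measurable_funTS; exact: measurable_cabs_sqr.
have s0 h x : D x -> (0 <= (cabs (h x : R[i]) ^+ 2)%:E)%E by rewrite lee_fin sqr_ge0.
rewrite /energy -!ge0_integralZl_EFin//; [|exact: s0|exact: m1|exact: s0|exact: m1].
rewrite -ge0_integralD//.
- apply: ge0_le_integral => //.
  + by move=> x _; rewrite lee_fin sqr_ge0.
  + by apply: m1; exact: cmeasurableD.
  + by apply: emeasurable_funD; apply: measurable_funeM; exact: m1.
  + by move=> x _; rewrite -!EFinM -EFinD lee_fin cabs_sqrD_le.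
- by move=> x Dx; rewrite mule_ge0// s0.
- by apply: measurable_funeM; exact: m1.
- by move=> x Dx; rewrite mule_ge0// s0.
- by apply: measurable_funeM; exact: m1.
Qed.

Lemma eL2norm_cvg0 (h : nat -> R -> R[i]) : eL2norm (h n) @[n --> \oo] --> 0%E ->
  forall e : R, 0 < e -> \forall n \near \oo, (energy setT (h n) <= e%:E)%E.
Proof.
move=> h0 e e0.
have m0 : 0 < Num.min 1 e by rewrite lt_min ltr01.
have : \forall n \near \oo, (eL2norm (h n) < (Num.min 1 e)%:E)%E.
  move/fine_cvgP : h0 => [fin cv].
  have lt := cvgr_lt _ cv _ m0.
  near=> n; rewrite -[ltLHS]fineK; last by near: n.
  by rewrite lte_fin; near: n; exact: lt.
apply: filterS => n.
rewrite energy_eL2norm.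
have : (0 <= eL2norm (h n))%E by exact: Lnorm_ge0.
case: (eL2norm (h n)) => [r| |]//=; rewrite !lee_fin lte_fin lt_min => r0 /andP[r1 re].
rewrite powR_mulrn// (le_trans _ (ltW re))// expr2 -[leRHS]mulr1 ler_wpM2l// ltW//.
Unshelve. all: by end_near. Qed.

End energy.

Section truncated.
Context {R : realType}.
Local Notation mu := (@lebesgue_measure R).
Local Notation mR := (measurableTypeR R).
Implicit Types (f g : R -> R[i]).

Definition window (n : nat) : set R := `[- n%:R, n%:R].
(** The restrictions to the window turn truncated transforms into integrals over
    the whole line, to which the real transforms cosT and sinT apply. *)
Definition cut_Re (n : nat) f : R -> R := (fun t => complex.Re (f t)) \_ (window n).
Definition cut_Im (n : nat) f : R -> R := (fun t => complex.Im (f t)) \_ (window n).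

Lemma measurable_window n : measurable (window n).
Proof. exact: measurable_itv. Qed.

Lemma Re_truncated f n x : complex.Re (truncated_fourier f n x) =
  \int[mu]_t (cut_Re n f t * cos (x * t) + cut_Im n f t * sin (x * t)).
Proof.
rewrite /truncated_fourier /cintegral/= Rintegral_mkcond; apply: eq_Rintegral => t _.
rewrite /cut_Re /cut_Im /window /patch; case: ifPn => _; last by rewrite !mul0r addr0.
by rewrite /expi; case: (f t) => a b /=; rewrite cosN sinN; ring.
Qed.

Lemma Im_truncated f n x : complex.Im (truncated_fourier f n x) =
  \int[mu]_t (cut_Im n f t * cos (x * t) - cut_Re n f t * sin (x * t)).
Proof.
rewrite /truncated_fourier /cintegral/= Rintegral_mkcond; apply: eq_Rintegral => t _.
rewrite /cut_Re /cut_Im /window /patch; case: ifPn => _; last by rewrite !mul0r subr0.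
by rewrite /expi; case: (f t) => a b /=; rewrite cosN sinN; ring.
Qed.

Lemma measurable_cut f n : cmeasurable f ->
  measurable_fun [set: R] (cut_Re n f) /\ measurable_fun [set: R] (cut_Im n f).
Proof.
move=> [mr mi]; split; apply/(measurable_restrictT _ (measurable_window n));
  exact: measurable_funTS.
Qed.

Lemma cmeasurable_truncated f n : cmeasurable f -> cmeasurable (truncated_fourier f n).
Proof.
move=> mf; have [mr mi] := measurable_cut n mf.
have mr2 : measurable_fun setT (fun z : mR * mR => cut_Re n f z.2).
  exact: (measurableT_comp mr measurable_snd).
have mi2 : measurable_fun setT (fun z : mR * mR => cut_Im n f z.2).
  exact: (measurableT_comp mi measurable_snd).
have mc : measurable_fun setT (fun z : mR * mR => cos (z.1 * z.2) : R).
  apply: measurableT_comp measurable_prod_mul.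
  by apply: continuous_measurable_fun; exact: continuous_cos.
have ms : measurable_fun setT (fun z : mR * mR => sin (z.1 * z.2) : R).
  apply: measurableT_comp measurable_prod_mul.
  by apply: continuous_measurable_fun; exact: continuous_sin.
split.
- under eq_fun do rewrite Re_truncated.
  apply: (measurable_Rintegral_param (f := fun z =>
    cut_Re n f z.2 * cos (z.1 * z.2) + cut_Im n f z.2 * sin (z.1 * z.2))).
  by apply: measurable_funD; apply: measurable_funM.
- under eq_fun do rewrite Im_truncated.
  apply: (measurable_Rintegral_param (f := fun z =>
    cut_Im n f z.2 * cos (z.1 * z.2) - cut_Re n f z.2 * sin (z.1 * z.2))).
  by apply: measurable_funB; apply: measurable_funM.
Qed.

Lemma fourier_cvg f g : is_fourier f g ->
  forall e : R, 0 < e -> \forall n \near \oo,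
    (energy setT (fun x => truncated_fourier f n x - g x)%R <= e%:E)%E.
Proof. by move=> [_ _ h]; exact: (eL2norm_cvg0 h). Qed.

Lemma energy_cabs_eq (D : set R) f g :
  (forall x, cabs (f x) = cabs (g x)) -> energy D f = energy D g.
Proof. by move=> fg; apply: eq_integral => x _; rewrite fg. Qed.

Lemma energyS (A B : set R) f : measurable A -> measurable B -> cmeasurable f ->
  A `<=` B -> (energy A f <= energy B f)%E.
Proof.
move=> mA mB mf AB; apply: ge0_subset_integral => //.
  by apply/measurable_EFinP/measurable_funTS; exact: measurable_cabs_sqr.
by move=> x _; rewrite lee_fin sqr_ge0.
Qed.

Lemma cabsN (z : R[i]) : cabs (- z) = cabs z.
Proof. by rewrite /cabs normrN. Qed.

(** The truncated transforms are pointwise bounded by B and approximate g in L2, so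
    g inherits the bound in the averaged sense, without identifying g with a
    pointwise limit. *)
Lemma fourier_energy_le f g (B : R) (E : set R) : is_fourier f g ->
  (forall n x, cabs (truncated_fourier f n x) <= B) -> measurable E ->
  (energy E g <= (2 * B ^+ 2)%:E * mu E)%E.
Proof.
move=> fg TB mE.
have [[mf _] [mg _] _] := fg.
have B0 : 0 <= B := le_trans (cabs_ge0 _) (TB 0%N 0).
apply/lee_addgt0Pr => e e0.
have e2 : 0 < e / 2 by rewrite divr_gt0.
have [n _ /(_ n (leqnn n)) H] := fourier_cvg fg e2.
have mT := cmeasurable_truncated n mf.
have mD : cmeasurable (fun x => truncated_fourier f n x - g x) by exact: cmeasurableB.
have mD' : cmeasurable (fun x => g x - truncated_fourier f n x) by exact: cmeasurableB.
have -> : energy E g = energy E (fun x => (g x - truncated_fourier f n x) + truncated_fourier f n x).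
  by apply: energy_cabs_eq => x; rewrite subrK.
apply: le_trans (energyD_le mE mD' mT) _.
rewrite addeC leeD//.
- have -> : ((2 * B ^+ 2)%:E * mu E = 2%:E * \int[mu]_(x in E) (B ^+ 2)%:E)%E.
    by rewrite (integral_cst mu mE (B ^+ 2)%:E) muleA -EFinM.
  rewrite lee_pmul2l//; apply: ge0_le_integral => //.
  + by move=> x _; rewrite lee_fin sqr_ge0.
  + by apply/measurable_EFinP/measurable_funTS; exact: measurable_cabs_sqr.
  + by move=> x _; rewrite lee_fin lerXn2r ?nnegrE// cabs_ge0.
- have -> : energy E (fun x => g x - truncated_fourier f n x) = energy E (fun x => truncated_fourier f n x - g x).
    by apply: energy_cabs_eq => x; rewrite -cabsN opprB.
  have -> : e%:E = (2%:E * (e / 2)%:E)%E by rewrite -EFinM mulrC divfK.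
  by rewrite lee_pmul2l//; apply: le_trans H; apply: energyS.
Qed.

End truncated.

(** * Energy of a function and of its transform *)

Section lower.
Context {R : realType}.
Local Notation mu := (@lebesgue_measure R).
Local Notation mR := (measurableTypeR R).
Implicit Types (f g : R -> R[i]).

Lemma ge0_integral_reflect (h : R -> \bar R) : measurable_fun [set: R] h ->
  (forall x, 0 <= h x)%E -> (\int[mu]_x h (- x)%R = \int[mu]_x h x)%E.
Proof.
move=> mh h0.
have mN : measurable_fun [set: mR] (-%R : mR -> mR) by exact: oppr_measurable.
rewrite -[LHS](@ge0_integral_pushforward _ _ mR mR _ (-%R) mN mu setT h)//.
apply: eq_measure_integral => //= A mA _; exact: lebesgue_measureN.
Qed.

Lemma windowS (n m : nat) : (n <= m)%N -> @window R n `<=` window m.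
Proof.
move=> nm x; rewrite /window/= !in_itv/= => /andP[h1 h2].
by rewrite (le_trans _ h1) ?lerN2 ?ler_nat// (le_trans h2)// ler_nat.
Qed.

Lemma bigcup_window : \bigcup_n (@window R n) = setT.
Proof.
apply/seteqP; split => // x _; have := archi_boundP (normr_ge0 x).
move=> /ltW; rewrite ler_norml => h.
by exists (Num.bound `|x|) => //; rewrite /window/= in_itv/=.
Qed.

Lemma cosTN (p : R -> R) x : cosT p (- x) = cosT p x.
Proof. by apply: eq_Rintegral => t _; rewrite mulNr cosN. Qed.

Lemma sinTN (p : R -> R) x : mu.-integrable [set: R] (EFin \o p) -> sinT p (- x) = - sinT p x.
Proof.
move=> ip; rewrite /sinT -[RHS]mulN1r -RintegralZl//; last exact: integrable_sin.
by apply: eq_Rintegral => t _; rewrite mulNr sinN mulN1r mulrN.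
Qed.

Lemma truncatedE f n x : 
  mu.-integrable [set: R] (EFin \o cut_Re n f) -> mu.-integrable [set: R] (EFin \o cut_Im n f) ->
  truncated_fourier f n x =
   (cosT (cut_Re n f) x + sinT (cut_Im n f) x) +i* (cosT (cut_Im n f) x - sinT (cut_Re n f) x).
Proof.
move=> iP iQ.
rewrite [LHS](_ : _ = complex.Re (truncated_fourier f n x) +i*
  complex.Im (truncated_fourier f n x)); last by case: truncated_fourier.
rewrite Re_truncated Im_truncated RintegralD ?RintegralB//;
  by [exact: integrable_cos|exact: integrable_sin].
Qed.

Lemma truncated_le f n x : 
  mu.-integrable [set: R] (EFin \o cut_Re n f) -> mu.-integrable [set: R] (EFin \o cut_Im n f) ->
  cabs (truncated_fourier f n x) <=
    2 * (\int[mu]_t `|cut_Re n f t| + \int[mu]_t `|cut_Im n f t|).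
Proof.
move=> iP iQ; rewrite truncatedE//; apply: le_trans (cabs_le_sum _) _ => /=.
have := cosT_le iP x; have := cosT_le iQ x; have := sinT_le iP x; have := sinT_le iQ x.
have := ler_normD (cosT (cut_Re n f) x) (sinT (cut_Im n f) x).
have := ler_normB (cosT (cut_Im n f) x) (sinT (cut_Re n f) x).
lra.
Qed.

Lemma cut_le f n (e : R -> R) : (forall t, cabs (f t) <= e t) ->
  (forall t, `|cut_Re n f t| <= e t) /\ (forall t, `|cut_Im n f t| <= e t).
Proof.
move=> fe; have e0 t : 0 <= e t := le_trans (cabs_ge0 _) (fe t).
split=> t; rewrite /cut_Re /cut_Im /patch; case: ifPn => _; rewrite ?normr0//.
  exact: le_trans (normr_Re_le _) (fe t).
exact: le_trans (normr_Im_le _) (fe t).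
Qed.

Lemma integrable_cut f n (M : R) : cmeasurable f -> (forall t, cabs (f t) <= M) ->
  mu.-integrable [set: R] (EFin \o cut_Re n f) /\ mu.-integrable [set: R] (EFin \o cut_Im n f).
Proof.
move=> [mr mi] fM.
have mW := @measurable_window R n.
have muW : (mu (window n) < +oo)%E.
  by rewrite /window lebesgue_measure_itv/=; case: ifPn => // _; rewrite -EFinB ltry.
have b (h : R -> R) : (forall t, `|h t| <= M) -> measurable_fun [set: R] h ->
    mu.-integrable [set: R] (EFin \o (h \_ (window n))).
  move=> hM mh.
  suff I0 : mu.-integrable (window n) (EFin \o h).
    by have := (@integrable_mkcond _ mR R mu (window n) (EFin \o h) mW).1 I0; rewrite restrict_EFin.
  apply: measurable_bounded_integrable => //; first exact: measurable_funTS.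
  exists M; split; first exact: num_real.
  by move=> y My t _; exact: le_trans (hM t) (ltW My).
split; apply: b => // t; first exact: le_trans (normr_Re_le _) (fM t).
exact: le_trans (normr_Im_le _) (fM t).
Qed.

(** Write f = p + i q on the window. At x and - x the cross terms between the
    transforms of p and q have opposite signs, so integrating over the line leaves
    the sum of the power spectra of p and q, and the real inequality applies to
    each of them. *)
Lemma energy_truncated f n (M : R) : cmeasurable f -> (forall t, cabs (f t) <= M) ->
  (kappa%:E * energy (window n) f <= energy setT (truncated_fourier f n))%E.
Proof.
move=> mf fM.
have [iP iQ] := integrable_cut n mf fM.
have [PM QM] := cut_le n fM.
set P := cut_Re n f in iP PM *; set Q := cut_Im n f in iQ QM *.
have [mP mQ] := measurable_cut n mf.
have mcP := measurable_cosT mP; have msP := measurable_sinT mP.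
have mcQ := measurable_cosT mQ; have msQ := measurable_sinT mQ.
have mT := cmeasurable_truncated n mf.
have E1 : (\int[mu]_x (cosT P x ^+ 2 + sinT P x ^+ 2)%:E +
           \int[mu]_x (cosT Q x ^+ 2 + sinT Q x ^+ 2)%:E
   <= energy setT (truncated_fourier f n))%E.
  have E2 : (energy setT (truncated_fourier f n) + energy setT (truncated_fourier f n) =
     2%:E * (\int[mu]_x (cosT P x ^+ 2 + sinT P x ^+ 2)%:E +
             \int[mu]_x (cosT Q x ^+ 2 + sinT Q x ^+ 2)%:E))%E.
    have mh : measurable_fun [set: R] (fun x => (cabs (truncated_fourier f n x) ^+ 2)%:E).
      by apply/measurable_EFinP; exact: measurable_cabs_sqr.
    have pos (p : R -> R) (x : R) : [set: R] x -> (0 <= (cosT p x ^+ 2 + sinT p x ^+ 2)%:E)%E.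
      by move=> _; rewrite lee_fin addr_ge0 ?sqr_ge0.
    have meas (p : R -> R) : measurable_fun [set: R] p ->
        measurable_fun [set: R] (fun x => (cosT p x ^+ 2 + sinT p x ^+ 2)%:E).
      move=> mp; apply/measurable_EFinP; apply: measurable_funD; apply: measurable_funX.
        exact: measurable_cosT.
      exact: measurable_sinT.
    have posT (x : R) : [set: R] x -> (0 <= (cabs (truncated_fourier f n x) ^+ 2)%:E)%E.
      by move=> _; rewrite lee_fin sqr_ge0.
    have posTN (x : R) : [set: R] x -> (0 <= (cabs (truncated_fourier f n (- x)) ^+ 2)%:E)%E.
      by move=> _; rewrite lee_fin sqr_ge0.
    have mhN : measurable_fun [set: R] (fun x => (cabs (truncated_fourier f n (- x)) ^+ 2)%:E).
      by apply: (measurableT_comp mh); exact: oppr_measurable.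
    rewrite -(@ge0_integralD _ mR R mu setT measurableT _ _ (pos P) (meas P mP) (pos Q) (meas Q mQ)).
    rewrite -ge0_integralZl_EFin//; last 2 first.
    - by move=> x _; rewrite -EFinD lee_fin !addr_ge0 ?sqr_ge0.
    - by apply: emeasurable_funD; exact: meas.
    (* one of the two copies of the energy is taken at - x *)
    rewrite {1}/energy -(ge0_integral_reflect mh); last by move=> x; rewrite lee_fin sqr_ge0.
    rewrite -(@ge0_integralD _ mR R mu setT measurableT _ _ posTN mhN posT mh).
    apply: eq_integral => x _; rewrite -!EFinD -EFinM; congr EFin.
    rewrite !truncatedE// !cabs_sqr /= -/P -/Q !cosTN !sinTN//.
    by ring.
  by rewrite -(@lee_pmul2l _ 2%:E)// -E2 mule_natl mule2n.
apply: le_trans E1.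
have -> : (energy (window n) f = (\int[mu]_x (P x ^+ 2))%:E + (\int[mu]_x (Q x ^+ 2))%:E)%E.
  rewrite -EFinD -RintegralD//; [|exact: integrable_sqr iP PM|exact: integrable_sqr iQ QM].
  rewrite /Rintegral fineK; last first.
    apply: integrable_fin_num => //.
    under eq_fun do rewrite EFinD.
    by apply: integrableD => //; [exact: integrable_sqr iP PM|exact: integrable_sqr iQ QM].
  rewrite /energy [LHS]integral_mkcond; apply: eq_integral => x _.
  rewrite /P /Q /cut_Re /cut_Im /patch; case: ifPn => _; last by rewrite expr0n/= addr0.
  by rewrite cabs_sqr.
have k0 : 0 <= kappa :> R by rewrite ltW// kappa_gt0.
rewrite muleDr//.
by apply: leeD; rewrite -EFinM; [exact: half_plancherel iP PM|exact: half_plancherel iQ QM].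
Qed.

(** The same inequality for the transform in the sense of Plancherel: pass to the
    limit in the truncated transforms, then let the window grow. *)
Lemma fourier_energy_ge f g (M : R) : is_fourier f g -> (forall t, cabs (f t) <= M) ->
  (kappa%:E * energy setT f <= 2%:E * energy setT g)%E.
Proof.
move=> fg fM; have [[mf _] [mg _] _] := fg.
have k0 : 0 < kappa :> R by exact: kappa_gt0.
have W n : (kappa%:E * energy (window n) f <= 2%:E * energy setT g)%E.
  apply/lee_addgt0Pr => e e0.
  have e2 : 0 < e / 2 by rewrite divr_gt0.
  have [N _ H] := fourier_cvg fg e2.
  pose m := maxn n N.
  have {}H := H m (leq_maxr n N).
  have mT := cmeasurable_truncated m mf.
  have mD : cmeasurable (fun x => truncated_fourier f m x - g x) by exact: cmeasurableB.
  apply: (@le_trans _ _ (kappa%:E * energy (window m) f)%E).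
    rewrite lee_pmul2l//; apply: energyS => //; [exact: measurable_window|exact: measurable_window|].
    by apply: windowS; exact: leq_maxl.
  apply: (le_trans (energy_truncated m mf fM)).
  have -> : energy setT (truncated_fourier f m) = energy setT (fun x => g x + (truncated_fourier f m x - g x)).
    by apply: energy_cabs_eq => x; rewrite addrC subrK.
  apply: le_trans (energyD_le measurableT mg mD) _.
  rewrite leeD//.
  have -> : e%:E = (2%:E * (e / 2)%:E)%E by rewrite -EFinM mulrC divfK.
  by rewrite lee_pmul2l.
have mE : measurable_fun [set: R] (fun x => (cabs (f x) ^+ 2)%:E).
  by apply/measurable_EFinP; exact: measurable_cabs_sqr.
have C : energy (window n) f @[n --> \oo] --> energy (\bigcup_n (window n)) f.
  apply: ge0_nondecreasing_set_cvg_integral => //.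
  - by move=> n m nm; apply/subsetPset; exact: windowS.
  - by move=> n; exact: measurable_window.
  - by move=> n; exact: measurable_funTS.
  - by move=> n x _; rewrite lee_fin sqr_ge0.
have -> : energy setT f = energy (\bigcup_n (window n)) f by rewrite bigcup_window.
have C2 : (kappa%:E * energy (window n) f)%E @[n --> \oo] --> (kappa%:E * energy (\bigcup_n (window n)) f)%E.
  exact: cvgeZl.
rewrite -(cvg_lim _ C2)//; apply: lime_le; last by near=> n; exact: W.
by apply/cvg_ex; eexists; exact: C2.
Unshelve. all: by end_near. Qed.

End lower.

(** * Transforms of dilated atoms *)

Section dilation.
Context {R : realType}.
Local Notation mu := (@lebesgue_measure R).
Local Notation mR := (measurableTypeR R).
Implicit Types (f g : R -> R[i]).

Lemma sqr_powR2_half (m : nat) : ((2 : R) `^ (m%:R / 2)) ^+ 2 = 2 ^+ m.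
Proof. by rewrite -powR_mulrn ?powR_ge0// -powRrM divfK// powR_mulrn. Qed.

Lemma gt0_RintegralZl (b : R) (D : set R) (f : R -> R) : 0 < b -> measurable D ->
  measurable_fun D f -> \int[mu]_(x in D) (b * f x) = b * \int[mu]_(x in D) f x.
Proof.
move=> b0 mD mf; rewrite /Rintegral.
have mF : measurable_fun D (EFin \o f) by exact/measurable_EFinP.
have -> : (\int[mu]_(x in D) (b * f x)%:E = b%:E * \int[mu]_(x in D) (f x)%:E)%E.
  under eq_integral do rewrite EFinM.
  rewrite integralE [in RHS]integralE.
  rewrite ge0_funeposM ?ge0_funenegM ?(ltW b0)//.
  rewrite !ge0_integralZl_EFin ?(ltW b0)//; [|exact: measurable_funeneg|exact: measurable_funepos].
  by apply: gt0_muleBr => //; exact: integral_ge0.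
case: (integral _ _ _) => [u| |] /=; first by [].
- by rewrite mulry gtr0_sg// mul1e/= mulr0.
- by rewrite mulrNy gtr0_sg// mul1e/= mulr0.
Qed.

Lemma preimage_window (m n : nat) :
  ( *%R ((2 : R) ^+ m)) @^-1` (window (2 ^ m * n)) = @window R n.
Proof.
have c0 : 0 < (2 : R) ^+ m by rewrite exprn_gt0.
apply/seteqP; split=> x; rewrite /window/= !in_itv/= natrM natrX -mulrN !ler_pM2l//.
Qed.

Lemma expi_scale (c x t : R) : c != 0 -> expi (- (x * t)) = expi (- (x / c * (c * t))).
Proof. by move=> c0; congr expi; rewrite mulrA divfK. Qed.

(** Dilation by 2 ^+ m maps the window of size n onto the window of size
    2 ^ m * n; since this is again an integer, truncations go to truncations. *)
Lemma truncated_atom psi (m n : nat) (x : R) : cmeasurable psi ->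
  truncated_fourier (wavelet_atom psi m 0) n x =
  (((2 : R) `^ (m%:R / 2))^-1)%:C * truncated_fourier psi (2 ^ m * n) (x / 2 ^+ m).
Proof.
move=> mpsi; set b := 2 `^ _; set c := 2 ^+ m.
have b0 : 0 < b by rewrite powR_gt0.
have c0 : 0 < c by rewrite exprn_gt0.
have bc : b ^+ 2 = c by exact: sqr_powR2_half.
have bc' : c^-1 * b = b^-1.
  by rewrite -bc expr2 invfM mulfVK// gt_eqF.
have mW := @measurable_window R (2 ^ m * n).
have mcos (y : R) : measurable_fun [set: R] (fun u => cos (- (y * u))).
  by under eq_fun do rewrite cosN; exact: measurable_cosM.
have msin (y : R) : measurable_fun [set: R] (fun u => sin (- (y * u))).
  by under eq_fun do rewrite sinN; apply: measurableT_comp => //; exact: measurable_sinM.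
have [mr mi] := mpsi.
have mRe (y : R) : measurable_fun [set: R] (fun u => complex.Re (expi (- (y * u)) * psi u)).
  have -> : (fun u => complex.Re (expi (- (y * u)) * psi u)) =
     (fun u => cos (- (y * u)) * complex.Re (psi u) - sin (- (y * u)) * complex.Im (psi u)).
    by apply/funext => u; rewrite /expi; case: (psi u).
  by apply: measurable_funB; apply: measurable_funM.
have mIm (y : R) : measurable_fun [set: R] (fun u => complex.Im (expi (- (y * u)) * psi u)).
  have -> : (fun u => complex.Im (expi (- (y * u)) * psi u)) =
     (fun u => cos (- (y * u)) * complex.Im (psi u) + sin (- (y * u)) * complex.Re (psi u)).
    by apply/funext => u; rewrite /expi; case: (psi u).
  by apply: measurable_funD; apply: measurable_funM.
have atomE t : expi (- (x * t)) * wavelet_atom psi m 0 t =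
    b%:C * (expi (- (x / c * (c * t))) * psi (c * t)).
  rewrite (expi_scale _ _ (lt0r_neq0 c0)) /wavelet_atom subr0 mulrCA; congr (_ * _).
rewrite /truncated_fourier /cintegral -/(window _) -/(window _).
rewrite -(preimage_window m n).
have ReC (z : R[i]) : complex.Re (b%:C * z) = b * complex.Re z.
  by case: z => ? ? /=; rewrite mul0r subr0.
have ImC (z : R[i]) : complex.Im (b%:C * z) = b * complex.Im z.
  by case: z => ? ? /=; rewrite mul0r addr0.
under eq_Rintegral do rewrite atomE ReC.
under [X in _ +i* X]eq_Rintegral do rewrite atomE ImC.
rewrite (@integral_scale _ c _ (fun u => b * complex.Re (expi (- (x / c * u)) * psi u)))//; last first.
  by apply: measurable_funM => //; exact: measurable_funTS.
rewrite (@integral_scale _ c _ (fun u => b * complex.Im (expi (- (x / c * u)) * psi u)))//; last first.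
  by apply: measurable_funM => //; exact: measurable_funTS.
rewrite !gt0_RintegralZl//; [|exact: measurable_funTS|exact: measurable_funTS].
by rewrite !mulrA bc' /=; apply/eqP; rewrite eq_complex/= !mul0r subr0 addr0 !eqxx.
Qed.

Lemma cmeasurable_scale f (c : R) : cmeasurable f -> cmeasurable (fun x => f (c * x)).
Proof.
move=> [mr mi]; have mc : measurable_fun [set: R] ( *%R c) by exact: mulrl_measurable.
by split; [exact: (measurableT_comp mr mc)|exact: (measurableT_comp mi mc)].
Qed.

Lemma cmeasurable_realM f (w : R -> R) : measurable_fun [set: R] w -> cmeasurable f ->
  cmeasurable (fun x => (w x)%:C * f x).
Proof.
move=> mw [mr mi]; split.
- have -> : (fun t => complex.Re ((w t)%:C * f t)) = (fun t => w t * complex.Re (f t)).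
    by apply/funext => t; case: (f t) => ? ? /=; rewrite mul0r subr0.
  exact: measurable_funM.
- have -> : (fun t => complex.Im ((w t)%:C * f t)) = (fun t => w t * complex.Im (f t)).
    by apply/funext => t; case: (f t) => ? ? /=; rewrite mul0r addr0.
  exact: measurable_funM.
Qed.

Lemma energy_atom_scale (m : nat) f : cmeasurable f ->
  energy setT (fun x => (((2 : R) `^ (m%:R / 2))^-1)%:C * f (x / 2 ^+ m)) = energy setT f.
Proof.
move=> mf; set b := 2 `^ _; set c := 2 ^+ m.
have b0 : 0 < b by rewrite powR_gt0.
have c0 : 0 < c by rewrite exprn_gt0.
have bc : b ^+ 2 = c by exact: sqr_powR2_half.
have mF : measurable_fun [set: R] (fun x => (cabs (f x) ^+ 2)%:E).
  by apply/measurable_EFinP; exact: measurable_cabs_sqr.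
rewrite /energy.
transitivity (\int[mu]_x ((c^-1)%:E * (cabs (f (c^-1 * x)) ^+ 2)%:E))%E.
  apply: eq_integral => x _; rewrite -EFinM cabsM cabsC ger0_norm ?invr_ge0 ?(ltW b0)//.
  by rewrite exprMn exprVn bc [c^-1 * x]mulrC.
have c'0 : 0 < c^-1 by rewrite invr_gt0.
rewrite ge0_integralZl_EFin ?(ltW c'0)//; last 2 first.
- by move=> x _; rewrite lee_fin sqr_ge0.
- apply: (measurableT_comp mF); exact: mulrl_measurable.
have := ge0_integral_scale c'0 measurableT mF (fun x _ => _).
rewrite preimage_setT => ->; last by move=> x; rewrite lee_fin sqr_ge0.
by rewrite muleA -EFinM invrK mulVf ?mul1e// gt_eqF.
Qed.

(** A transform in the sense of Plancherel is determined up to a null set, so the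
    transform of the atom at scale m is the dilate of the transform of psi; this
    is recorded as a vanishing energy. *)
Lemma fourier_atom_energy psi G g (m : nat) :
  is_fourier psi G -> is_fourier (wavelet_atom psi m 0) g ->
  energy setT (fun x => g x - (((2 : R) `^ (m%:R / 2))^-1)%:C * G (x / 2 ^+ m)) = 0%E.
Proof.
move=> hpsi hatom.
have [[mpsi _] [mG _] _] := hpsi; have [[matom _] [mg _] _] := hatom.
set b := 2 `^ _; set c := 2 ^+ m.
apply/eqP; rewrite eq_le energy_ge0 andbT; apply/lee_addgt0Pr => e e0; rewrite add0e.
have e4 : 0 < e / 4 by rewrite divr_gt0.
have [N1 _ H1] := fourier_cvg hpsi e4.
have [N2 _ H2] := fourier_cvg hatom e4.
pose n := maxn N1 N2.
have {}H2 := H2 n (leq_maxr _ _).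
have {}H1 : (energy setT (fun x => truncated_fourier psi (2 ^ m * n) x - G x)%R <= (e / 4)%:E)%E.
  by apply: H1; rewrite /= (leq_trans (leq_maxl N1 N2))// leq_pmull// expn_gt0.
have mT1 := cmeasurable_truncated n matom.
have mT2 := cmeasurable_truncated (2 ^ m * n) mpsi.
have mD := cmeasurableB mT2 mG.
have mcst : measurable_fun [set: R] (fun=> b^-1) by exact: measurable_cst.
have msc h : cmeasurable h -> cmeasurable (fun x => h (x / c)).
  by move=> mh; under eq_fun do rewrite mulrC; exact: cmeasurable_scale.
have -> : energy setT (fun x => g x - (b^-1)%:C * G (x / c)) =
  energy setT (fun x => (g x - truncated_fourier (wavelet_atom psi m 0) n x) +
    (b^-1)%:C * (truncated_fourier psi (2 ^ m * n) (x / c) - G (x / c))).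
  by apply: energy_cabs_eq => x; rewrite truncated_atom// mulrBr addrA subrK.
apply: (le_trans (energyD_le measurableT _ _)).
- exact: cmeasurableB.
- exact: cmeasurable_realM (msc _ mD).
have -> : energy setT (fun x => (b^-1)%:C * (truncated_fourier psi (2 ^ m * n) (x / c) - G (x / c)))
  = energy setT (fun x => truncated_fourier psi (2 ^ m * n) x - G x).
  exact: (energy_atom_scale m mD).
have -> : energy setT (fun x => g x - truncated_fourier (wavelet_atom psi m 0) n x) =
  energy setT (fun x => truncated_fourier (wavelet_atom psi m 0) n x - g x).
  by apply: energy_cabs_eq => x; rewrite -cabsN opprB.
have -> : e%:E = (2%:E * (e / 4)%:E + 2%:E * (e / 4)%:E)%E.
  by rewrite -EFinM -EFinD; congr EFin; field.
by apply: leeD; rewrite lee_pmul2l.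
Qed.

(** Vanishing energy means equality almost everywhere, which a weight w preserves. *)
Lemma energy_sub_eq0 g h (w : R -> R) (E : set R) : measurable E ->
  cmeasurable g -> cmeasurable h -> measurable_fun [set: R] w ->
  energy setT (fun x => g x - h x) = 0%E ->
  energy E (fun x => (w x)%:C * g x) = energy E (fun x => (w x)%:C * h x).
Proof.
move=> mE mg mh mw e0.
have mD : measurable_fun [set: mR] (fun x => (cabs (g x - h x) ^+ 2)%:E).
  by apply/measurable_EFinP; apply: measurable_cabs_sqr; exact: cmeasurableB.
have : ae_eq mu setT (fun x => (cabs (g x - h x) ^+ 2)%:E) (cst 0%E).
  apply/(ae_eq_integral_abs mu measurableT mD).
  rewrite -[RHS]e0; apply: eq_integral => x _.
  by rewrite gee0_abs// lee_fin sqr_ge0.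
move=> [N [mN N0 sub]].
have m2 k : cmeasurable k -> measurable_fun E (fun x => (cabs ((w x)%:C * k x) ^+ 2)%:E).
  move=> mk; apply/measurable_EFinP/measurable_funTS; apply: measurable_cabs_sqr.
  exact: cmeasurable_realM.
apply: ge0_ae_eq_integral => //; [exact: m2|exact: m2| | |].
- by move=> x _; rewrite lee_fin sqr_ge0.
- by move=> x _; rewrite lee_fin sqr_ge0.
exists N; split => //; apply: (subset_trans _ sub); apply: subsetC => x /= hx _.
have /eqP := EFin_inj (hx I).
rewrite sqrf_eq0 => /eqP c0; congr EFin; congr (cabs (_ * _) ^+ 2); apply/eqP.
rewrite -subr_eq0 -normr_eq0.
move: c0; rewrite /cabs normc_def => /= ->.
by rewrite eq_complex/= !eqxx.
Qed.

End dilation.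

(** * Concentration of tilted energy *)

Section concentration.
Context {R : realType}.
Local Notation mu := (@lebesgue_measure R).
Local Notation mR := (measurableTypeR R).
Lemma absorb_quarters (X Y : \bar R) : (0 <= X)%E -> (X < +oo)%E -> (0 <= Y)%E ->
  (X <= Y + ((4^-1)%:E * X + (4^-1)%:E * X))%E -> (X <= 2%:E * Y)%E.
Proof.
move=> X0 Xy Y0; have Xf : X \is a fin_num by rewrite ge0_fin_numE.
have [Yf|] := boolP (Y \is a fin_num); last first.
  by rewrite ge0_fin_numE// -leNgt leye_eq => /eqP ->; rewrite gt0_muley// leey.
rewrite -(fineK Xf) -(fineK Yf) -!EFinM -!EFinD !lee_fin; lra.
Qed.

Variables (gamma a : R) (u : R -> R).
Hypotheses (gamma_gt0 : 0 < gamma) (a_gt0 : 0 < a) (mu_ : measurable_fun [set: R] u).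

(** The transform of the unnormalised Psi^(m, 0) at frequency 2 ^+ m * y, up to the
    factor 2 ^ (- m / 2), when u is the transform of the wavelet. *)
Definition tilt (m : nat) (y : R) : R := expR (`|2 ^+ m * y| `^ gamma) * u y.

Definition tilted_energy (m : nat) (A : set R) : \bar R :=
  (\int[mu]_(y in A) (tilt m y ^+ 2)%:E)%E.

Lemma measurable_tilt m : measurable_fun [set: R] (tilt m).
Proof.
apply: measurable_funM => //; apply: measurableT_comp => //.
apply: (@measurableT_comp _ _ _ _ _ _ (@powR R ^~ gamma)); first exact: measurable_powR.
by apply: measurableT_comp => //; exact: mulrl_measurable.
Qed.

Let mt m : measurable_fun [set: R] (fun y => (tilt m y ^+ 2)%:E).
Proof. by apply/measurable_EFinP; apply: measurable_funX; exact: measurable_tilt. Qed.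

Let u2 := (\int[mu]_y (u y ^+ 2)%:E)%E.

Lemma tilt_sqr m y : tilt m y ^+ 2 = expR (2 * (2 ^+ m) `^ gamma * `|y| `^ gamma) * u y ^+ 2.
Proof.
have E (z : R) : expR z ^+ 2 = expR (2 * z) by rewrite expr2 -expRD; congr expR; ring.
rewrite /tilt exprMn E normrM powRM// ger0_norm ?exprn_ge0//.
by rewrite mulrA.
Qed.

(** The tilt makes the energy concentrate near the two ends of [-a, a] as m grows:
    what lies in |y| < a - e is at most exp (L (a - e) ^ gamma) times a constant, and
    what lies in [a - e / 2, a] is at least exp (L (a - e / 2) ^ gamma) times a positive
    constant, where L = 2 (2 ^ m) ^ gamma is unbounded. A density bound K prevents this:
    the two end intervals of length e carry at most 2 K e <= 1 / 2 of the energy. *)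
Lemma no_spreading (K : R) : (forall x, a < `|x| -> u x = 0) -> (u2 < +oo)%E ->
  (forall e, 0 < e -> (0 < \int[mu]_(y in `[(a - e)%R, a]%classic) (u y ^+ 2)%:E)%E) -> 0 <= K ->
  (forall m, (tilted_energy m setT < +oo)%E) ->
  (forall m A, measurable A -> (tilted_energy m A <= K%:E * mu A * tilted_energy m setT)%E) ->
  False.
Proof.
move=> supp u2fin pos K0 fin spread.
(* so small that each end interval carries at most a quarter of the energy, and at
   most a / 2 so that a - e stays nonnegative *)
pose e := Num.min (a / 2) (4 * (K + 1))^-1.
have K1 : 0 < K + 1 by rewrite ltr_wpDl.
have e0 : 0 < e by rewrite lt_min divr_gt0//= invr_gt0 mulr_gt0.
have ea : e <= a / 2 by rewrite ge_min lexx.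
have eK : K * e <= 4^-1.
  apply: (@le_trans _ _ ((K + 1) * (4 * (K + 1))^-1)).
    by rewrite ler_pM ?(ltW e0)// ?lerDl// ge_min lexx orbT.
  by rewrite invfM mulrCA mulfV ?mulr1// gt_eqF.
pose A1 : set R := `[a - e, a]%classic.
pose A2 : set R := `[- a, - (a - e)]%classic.
pose I0 : set R := `]- (a - e), a - e[%classic.
have mA1 : measurable A1 by exact: measurable_itv.
have mA2 : measurable A2 by exact: measurable_itv.
have mI0 : measurable I0 by exact: measurable_itv.
have muA1 : mu A1 = e%:E.
  rewrite /A1 lebesgue_measure_itv/= lte_fin ltrBlDr ltrDl e0.
  by rewrite -EFinB opprB addrC subrK.
have muA2 : mu A2 = e%:E.
  rewrite /A2 lebesgue_measure_itv/= lte_fin ltrN2 ltrBlDr ltrDl e0.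
  by rewrite -EFinB opprK opprB addrNK.
have ae0 : 0 <= a - e by lra.
have split m : (tilted_energy m setT <= tilted_energy m I0 + (tilted_energy m A1 + tilted_energy m A2))%E.
  rewrite /tilted_energy (@integral_mkcond _ mR R mu I0).
  rewrite (@integral_mkcond _ mR R mu A1) (@integral_mkcond _ mR R mu A2).
  have P0 (A : set R) x : (0 <= ((fun y => (tilt m y ^+ 2)%:E) \_ A) x)%E.
    by rewrite /patch; case: ifPn => // _; rewrite lee_fin sqr_ge0.
  have PM (A : set R) : measurable A -> measurable_fun [set: R] ((fun y => (tilt m y ^+ 2)%:E) \_ A).
    by move=> mA; apply/(measurable_restrictT _ mA); exact: measurable_funTS.
  have PE (A : set R) x : x \in A -> ((fun y => (tilt m y ^+ 2)%:E) \_ A) x = (tilt m x ^+ 2)%:E.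
    by rewrite /patch => ->.
  have PD : measurable_fun [set: R] (fun x => ((fun y => (tilt m y ^+ 2)%:E) \_ A1) x +
      ((fun y => (tilt m y ^+ 2)%:E) \_ A2) x)%E.
    by apply: emeasurable_funD; exact: PM.
  rewrite -(@ge0_integralD _ mR R mu setT measurableT _ _
    (fun x _ => P0 A1 x) (PM A1 mA1) (fun x _ => P0 A2 x) (PM A2 mA2)).
  rewrite -(@ge0_integralD _ mR R mu setT measurableT _ _
    (fun x _ => P0 I0 x) (PM I0 mI0) (fun x _ => adde_ge0 (P0 A1 x) (P0 A2 x)) PD).
  apply: ge0_le_integral => //.
  - by move=> x _; rewrite lee_fin sqr_ge0.
  - exact: mt.
  - by apply: emeasurable_funD => //; exact: PM.
  move=> x _.
  have [/supp ux|xa] := ltP a `|x|.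
    have t0 : tilt m x = 0 by rewrite /tilt ux mulr0.
    by rewrite t0 expr0n; apply: adde_ge0 => //; exact: adde_ge0.
  have [xI|xI] := boolP (x \in I0).
    by rewrite (PE _ _ xI) leeDl// adde_ge0.
  have [xA|xA] := boolP (x \in A1).
    by rewrite (PE _ _ xA) addeCA leeDl// adde_ge0.
  have xA2 : x \in A2.
    move: xI xA xa; rewrite !notin_setE /I0 /A1 /A2 inE /= !in_itv/= => /negP xI /negP xA.
    rewrite ler_norml => /andP[h1 h2]; rewrite h1/=.
    move: xA; rewrite h2 andbT -ltNge => h3; move: xI; rewrite h3 andbT -leNgt//.
  by rewrite (PE _ _ xA2) addeA leeDr// adde_ge0.
have half m : (tilted_energy m setT <= 2%:E * tilted_energy m I0)%E.
  have s1 := spread m _ mA1; have s2 := spread m _ mA2; have := split m.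
  rewrite muA1 muA2 in s1 s2.
  have f0 : (0 <= tilted_energy m setT)%E by apply: integral_ge0 => x _; rewrite lee_fin sqr_ge0.
  have fI : (0 <= tilted_energy m I0)%E by apply: integral_ge0 => x _; rewrite lee_fin sqr_ge0.
  have f1 := fin m.
  have bound X : (X <= K%:E * e%:E * tilted_energy m setT)%E ->
      (X <= (4^-1)%:E * tilted_energy m setT)%E.
    by move=> h; apply: (le_trans h); rewrite -EFinM lee_wpmul2r.
  move=> h; have {}h := le_trans h (leeD (lexx _) (leeD (bound _ s1) (bound _ s2))).
  exact: absorb_quarters.
pose A : set R := `[a - e / 2, a]%classic.
have mA : measurable A by exact: measurable_itv.
have mu2 : measurable_fun [set: R] (fun y => (u y ^+ 2)%:E).
  by apply/measurable_EFinP; exact: measurable_funX.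
have e2 : 0 < e / 2 by rewrite divr_gt0.
have P0 := pos _ e2; rewrite -/A in P0.
set P := (\int[mu]_(y in A) (u y ^+ 2)%:E)%E in P0.
have Pu2 : (P <= u2)%E.
  by apply: ge0_subset_integral => // x _; rewrite lee_fin sqr_ge0.
have Pf : P \is a fin_num by rewrite ge0_fin_numE ?(ltW P0)// (le_lt_trans Pu2).
have uf : u2 \is a fin_num by rewrite ge0_fin_numE// (le_trans (ltW P0)).
pose al := (a - e) `^ gamma; pose be := (a - e / 2) `^ gamma.
have ab : al < be.
  by apply: gt0_ltr_powR; rewrite ?nnegrE//; lra.
pose la m : R := 2 * (2 ^+ m) `^ gamma.
have la0 m : 0 <= la m by rewrite mulr_ge0// powR_ge0.
have inner m : (tilted_energy m I0 <= (expR (la m * al))%:E * u2)%E.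
  rewrite -ge0_integralZl_EFin ?expR_ge0//; last by move=> x _; rewrite lee_fin sqr_ge0.
  apply: (@le_trans _ _ (\int[mu]_(y in I0) ((expR (la m * al))%:E * (u y ^+ 2)%:E))%E).
    apply: ge0_le_integral => //.
    - by move=> x _; rewrite lee_fin sqr_ge0.
    - exact: measurable_funTS (mt m).
    - by apply: measurable_funeM; exact: measurable_funTS.
    - move=> x; rewrite /I0/= in_itv/= => /andP[x1 x2].
      rewrite -EFinM lee_fin tilt_sqr ler_wpM2r ?sqr_ge0// ler_expR ler_wpM2l//.
      apply: ge0_ler_powR; rewrite ?nnegrE ?(ltW gamma_gt0)//.
      by rewrite ler_norml (ltW x1) (ltW x2).
  apply: ge0_subset_integral => //.
    by apply: measurable_funeM.
  by move=> x _; rewrite -EFinM lee_fin mulr_ge0 ?expR_ge0 ?sqr_ge0.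
have outer m : ((expR (la m * be))%:E * P <= tilted_energy m setT)%E.
  apply: (@le_trans _ _ (tilted_energy m A)); last first.
    apply: ge0_subset_integral => //; first exact: mt.
    by move=> x _; rewrite lee_fin sqr_ge0.
  rewrite -ge0_integralZl_EFin ?expR_ge0//; last 2 first.
  - by move=> x _; rewrite lee_fin sqr_ge0.
  - exact: measurable_funTS.
  apply: ge0_le_integral => //.
  - by move=> x _; rewrite -EFinM lee_fin mulr_ge0 ?expR_ge0 ?sqr_ge0.
  - by apply: measurable_funeM; exact: measurable_funTS.
  - exact: measurable_funTS (mt m).
  - move=> x; rewrite /A/= in_itv/= => /andP[x1 x2].
    rewrite -EFinM lee_fin tilt_sqr ler_wpM2r ?sqr_ge0// ler_expR ler_wpM2l//.
    apply: ge0_ler_powR; rewrite ?nnegrE ?(ltW gamma_gt0)//; first by lra.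
    by rewrite (le_trans x1)// ler_norm.
pose p := fine P; pose s := fine u2.
have p0 : 0 < p by rewrite -lte_fin fineK.
have key m : la m * (be - al) < 2 * s / p.
  have H := le_trans (outer m) (half m).
  have {}H := le_trans H (lee_wpmul2l (ltW (_ : 0 < 2%:E)%E) (inner m)).
  have {H} : expR (la m * be) * p <= 2 * (expR (la m * al) * s).
    by rewrite -lee_fin !EFinM /p /s !fineK//; apply: H.
  have -> : la m * be = la m * (be - al) + la m * al by ring.
  have -> : 2 * (expR (la m * al) * s) = 2 * s * expR (la m * al) by ring.
  rewrite expRD -mulrA [expR (la m * al) * p]mulrC mulrA.
  rewrite ler_pM2r ?expR_gt0// => H.
  rewrite ltr_pdivlMr//; apply: lt_le_trans H.
  by rewrite ltr_pM2r// (lt_le_trans _ (expR_ge1Dx _))// ltrDr.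
have ba : 0 < be - al by rewrite subr_gt0.
pose Z := 2 * s / p / (be - al).
have kZ m : la m < Z by rewrite ltr_pdivlMr.
have Z0 : 0 < Z by apply: le_lt_trans (la0 0%N) (kZ 0%N).
pose m := Num.bound (Z `^ gamma^-1).
have mZ : Z `^ gamma^-1 < m%:R by rewrite archi_boundP// powR_ge0.
have m2 : m%:R <= 2 ^+ m :> R by rewrite -natrX ler_nat ltnW// ltn_expl.
have : Z < (2 ^+ m) `^ gamma.
  have <- : (Z `^ gamma^-1) `^ gamma = Z.
    by rewrite -powRrM mulVf ?gt_eqF// powRr1// ltW.
  apply: gt0_ltr_powR; rewrite ?nnegrE ?powR_ge0 ?exprn_ge0//.
  exact: lt_le_trans mZ m2.
move=> Zm; have := lt_trans (kZ m) Zm.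
by rewrite /la ltNge ler_peMl ?powR_ge0// ler1n.
Qed.

End concentration.

(** * Behaviour at the edge of the support *)

Section support_edge.
Context {R : realType}.
Local Notation mu := (@lebesgue_measure R).

Lemma derive1n_vanish (f : R -> R) (b c : R) : (forall x, b < x < c -> f x = 0) ->
  forall k x, b < x < c -> derive1n k f x = 0.
Proof.
move=> f0; elim=> [|k IH] x bxc; first exact: f0.
rewrite derive1nS derive1E.
rewrite (@near_eq_derive _ _ _ _ (cst 0)) ?oner_eq0 ?derive_cst//.
have /andP[bx xc] := bxc.
near=> y; apply: IH; apply/andP; split; near: y.
  exact: lt_nbhsr.
exact: lt_nbhsl.
Unshelve. all: by end_near. Qed.

(** If f vanished on an interval ending at a, so would its derivative of order
    r - 1, and the left difference quotients at a would be 0. *)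
Lemma nonzero_near_edge (f : R -> R) (a l : R) (r : nat) :
  derive1n r.-1 f a = 0 -> is_left_derive r f a l -> l != 0 ->
  forall e, 0 < e -> exists2 y, a - e < y < a & f y != 0.
Proof.
move=> fa fl l0 e e0; apply: contrapT => H.
have f0 x : a - e < x < a -> f x = 0.
  by move=> xa; apply: contrapT => /eqP fx; apply: H; exists x.
have D := derive1n_vanish f0 r.-1.
move/eqP : l0; apply.
have C : (derive1n r.-1 f (a + h) - derive1n r.-1 f a) / h @[h --> 0^'-] --> (0 : R).
  apply: cvg_near_cst; near=> h.
  rewrite fa D ?subrr ?mul0r//.
  have h0 : h < 0 by near: h; exact: nbhs_left_lt.
  have he : - e < h by near: h; apply: nbhs_left_gt; rewrite oppr_lt0.
  by apply/andP; split; lra.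
by apply: (cvg_unique _ fl C).
Unshelve. all: by end_near. Qed.

Lemma integral_sqr_gt0 (f : R -> R) (b c y : R) : continuous f -> b < y < c -> f y != 0 ->
  (0 < \int[mu]_(x in `[b, c]%classic) (f x ^+ 2)%:E)%E.
Proof.
move=> cf /andP[byy yc] fy.
have mf : measurable_fun [set: R] f by exact: continuous_measurable_fun.
have q0 : 0 < `|f y| / 2 by rewrite divr_gt0// normr_gt0.
have N3 : \forall x \near y, `|f y| / 2 < `|f x|.
  have C : `|f x| @[x --> y] --> `|f y| by apply: cvg_norm; exact: cf.
  by apply: (cvgr_gt _ C); rewrite ltr_pdivrMr// ltr_pMr ?normr_gt0// ltr1n.
have [d /= d0 H] := (nbhs_ballP _ _).1 (filterI (lt_nbhsr byy) (filterI (lt_nbhsl yc) N3)).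
have mB : measurable (ball y d : set R) by exact: measurable_ball.
have mF (D : set R) : measurable D -> measurable_fun D (fun x => (f x ^+ 2)%:E).
  by move=> mD; apply/measurable_EFinP/measurable_funTS; exact: measurable_funX.
apply: (@lt_le_trans _ _ (\int[mu]_(x in ball y d) (f x ^+ 2)%:E)%E); last first.
  apply: ge0_subset_integral => //.
  - exact: mF.
  - by move=> x _; rewrite lee_fin sqr_ge0.
  - by move=> x /H[/= bx [xc _]]; rewrite /= in_itv/= (ltW bx) (ltW xc).
apply: (@lt_le_trans _ _ (\int[mu]_(x in ball y d) ((`|f y| / 2) ^+ 2)%:E)%E).
  rewrite (integral_cst mu mB ((`|f y| / 2) ^+ 2)%:E)/= (lebesgue_measure_ball _ (ltW d0)).
  by rewrite -EFinM lte_fin mulr_gt0 ?exprn_gt0// mulrn_wgt0.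
apply: ge0_le_integral => //.
- exact: mF.
- move=> x /H[/= _ [_ h]]; rewrite lee_fin -[leRHS]real_normK ?num_real//.
  by rewrite lerXn2r ?nnegrE ?(ltW q0)// ltW.
Qed.

End support_edge.

(** * Energy density of localized functions *)

Section vaguelet_bound.
Context {R : realType}.
Local Notation mu := (@lebesgue_measure R).
Local Notation mR := (measurableTypeR R).
Implicit Types (f g : R -> R[i]).

(** The change of variables x = 2 ^+ m * y, in the frequency domain. *)
Lemma energy_dilate (gamma : R) (psi : R -> R[i]) (psihat : R -> R) g (m : nat) (A : set R) :
  is_fourier psi (fun x => (psihat x)%:C) -> is_fourier (wavelet_atom psi m 0) g -> measurable A ->
  energy ( *%R (2 ^- m) @^-1` A) (fun x => (((h2 gamma x)^-1)%:C)^* * g x) =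
  tilted_energy gamma psihat m A.
Proof.
move=> hpsi hg mA.
have [_ [mG _] _] := hpsi; have [_ [mg _] _] := hg.
have mp : measurable_fun [set: R] psihat by case: mG.
set c : R := 2 ^+ m; set b : R := 2 `^ (m%:R / 2).
have b0 : 0 < b by rewrite powR_gt0.
have c0 : 0 < c by rewrite exprn_gt0.
have c'0 : 0 < c^-1 by rewrite invr_gt0.
have bc : b ^+ 2 = c by exact: sqr_powR2_half.
pose w x := (h2 gamma x)^-1.
have wE x : w x = expR (`|x| `^ gamma) by rewrite /w /h2 expRN invrK.
have mw : measurable_fun [set: R] w.
  rewrite (funext wE : w = _); apply: measurableT_comp => //.
  by apply: (@measurableT_comp _ _ _ _ _ _ (@powR R ^~ gamma)) => //; exact: measurable_powR.
have mE : measurable ( *%R c^-1 @^-1` A : set R).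
  rewrite -[X in measurable X]setTI.
  have mc : measurable_fun [set: R] ( *%R c^-1) by exact: mulrl_measurable.
  exact: mc.
have mh : cmeasurable (fun x => (b^-1)%:C * (psihat (x / c))%:C).
  apply: cmeasurable_realM; first exact: measurable_cst.
  have := cmeasurable_scale c^-1 mG.
  by congr cmeasurable; apply/funext => x; rewrite mulrC.
have U := fourier_atom_energy hpsi hg.
have -> : (fun x => (((h2 gamma x)^-1)%:C)^* * g x) = (fun x => (w x)%:C * g x).
  by apply/funext => x; congr (_ * _); exact: conjc_real.
rewrite (energy_sub_eq0 mE mg mh mw U).
have mt : measurable_fun A (fun y => (tilt gamma psihat m y ^+ 2)%:E).
  by apply/measurable_EFinP/measurable_funTS/measurable_funX; exact: measurable_tilt.
transitivity (\int[mu]_(x in *%R c^-1 @^-1` A)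
    ((c^-1)%:E * (tilt gamma psihat m (c^-1 * x) ^+ 2)%:E))%E.
  apply: eq_integral => x _; rewrite -EFinM; congr EFin.
  rewrite !cabsM !cabsC !exprMn.
  rewrite !real_normK ?num_real// [b^-1 ^+ 2]exprVn bc.
  rewrite -/c mulVKf ?gt_eqF// wE [c^-1 * x]mulrC.
  by ring.
have s0 y : A y -> (0 <= (c^-1)%:E * (tilt gamma psihat m y ^+ 2)%:E)%E.
  by move=> _; rewrite -EFinM lee_fin mulr_ge0 ?sqr_ge0// ltW.
rewrite (ge0_integral_scale
  (f := fun y => ((c^-1)%:E * (tilt gamma psihat m y ^+ 2)%:E)%E) c'0 mA)//; last first.
  by apply: measurable_funeM.
rewrite ge0_integralZl_EFin ?(ltW c'0)//; last first.
  by move=> y _; rewrite lee_fin sqr_ge0.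
by rewrite muleA -EFinM invrK mulfV ?mul1e// gt_eqF.
Qed.

(** This covers the degenerate case of a vanishing norm, where normalisation
    divides by zero. *)
Lemma truncated_null f n x : cmeasurable f -> energy setT f = 0%E ->
  cabs (truncated_fourier f n x) <= 0.
Proof.
move=> mf f0.
have [mP mQ] := measurable_cut n mf.
have key (h : R -> R) : measurable_fun [set: R] h -> (forall t, h t ^+ 2 <= cabs (f t) ^+ 2) ->
    mu.-integrable [set: R] (EFin \o h) /\ \int[mu]_t `|h t| = 0.
  move=> mh hf.
  have mhE : measurable_fun [set: mR] (EFin \o h) by exact/measurable_EFinP.
  have mh2 : measurable_fun [set: mR] (fun t => (h t ^+ 2)%:E).
    by apply/measurable_EFinP; exact: measurable_funX.
  have h0 : (\int[mu]_t `|(h t ^+ 2)%:E| = 0)%E.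
    apply/eqP; rewrite eq_le integral_ge0// andbT -f0.
    apply: ge0_le_integral => //.
    - exact: measurableT_comp.
    - by apply/measurable_EFinP; exact: measurable_cabs_sqr.
    - by move=> t _; rewrite gee0_abs ?lee_fin ?sqr_ge0.
  have ae : ae_eq mu setT (EFin \o h) (cst 0%E).
    have [N [mN N0 sub]] := (ae_eq_integral_abs mu measurableT mh2).1 h0.
    exists N; split => //; apply: (subset_trans _ sub); apply: subsetC => t /= ht _.
    have /eqP := EFin_inj (ht I); rewrite sqrf_eq0 => /eqP ->; done.
  have i0 := (ae_eq_integral_abs mu measurableT mhE).2 ae.
  split; first by apply/integrableP; split => //; rewrite i0.
  by rewrite /Rintegral; rewrite i0.
have [PC QC] := cut_le n (fun t => lexx (cabs (f t))).
have sq (h : R -> R) : (forall t, `|h t| <= cabs (f t)) -> forall t, h t ^+ 2 <= cabs (f t) ^+ 2.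
  by move=> hf t; rewrite -real_normK ?num_real// lerXn2r ?nnegrE ?cabs_ge0.
have [iP P0] := key _ mP (sq _ PC); have [iQ Q0] := key _ mQ (sq _ QC).
by apply: le_trans (truncated_le x iP iQ) _; rewrite P0 Q0 addr0 mulr0.
Qed.

Definition envelope_mass (alpha : R) : R := \int[mu]_x (1 + `|x|) `^ (- 1 - alpha).

Lemma envelope_mass_fin (alpha : R) : 0 < alpha ->
  (\int[mu]_x ((1 + `|x|) `^ (- 1 - alpha))%:E = (envelope_mass alpha)%:E)%E.
Proof.
move=> a0; rewrite /envelope_mass /Rintegral fineK// ge0_fin_numE ?integral_envelope//.
by apply: integral_ge0 => x _; rewrite lee_fin powR_ge0.
Qed.

(** The envelope has integral D * envelope_mass alpha / 2 ^+ m, and this bounds all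
    truncated transforms of f up to a factor 4, hence the energy density of H. *)
Lemma localized_energy_spread (alpha D : R) (m : nat) f H (E : set R) :
  0 < alpha -> 0 <= D -> is_fourier f H -> measurable E ->
  (forall t, cabs (f t) <= D * (1 + `|2 ^+ m * t|) `^ (- 1 - alpha)) ->
  (energy E H <= (32 * (D * envelope_mass alpha / 2 ^+ m) ^+ 2)%:E * mu E)%E.
Proof.
move=> a0 D0 fH mE fD.
have [[mf _] _ _] := fH.
have c0 : 0 < (2 : R) ^+ m by rewrite exprn_gt0.
pose e t : R := D * (1 + `|2 ^+ m * t|) `^ (- 1 - alpha).
have me1 : measurable_fun [set: R] (fun x : R => (1 + `|x|) `^ (- 1 - alpha)).
  by apply: continuous_measurable_fun; exact: continuous_envelope.
have e0 t : 0 <= e t by rewrite mulr_ge0// powR_ge0.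
have eD t : e t <= D.
  by rewrite ler_piMr// envelope_le1// ltW.
have ie : (\int[mu]_t (e t)%:E = (D * envelope_mass alpha / 2 ^+ m)%:E)%E.
  rewrite /e; under eq_integral do rewrite EFinM.
  have mc : measurable_fun [set: R] ( *%R ((2 : R) ^+ m)) by exact: mulrl_measurable.
  have sm : measurable_fun [set: mR] (fun t : R => ((1 + `|2 ^+ m * t|) `^ (- 1 - alpha))%:E).
    by apply/measurable_EFinP; exact: (measurableT_comp me1 mc).
  have s0 (t : R) : [set: mR] t -> (0 <= ((1 + `|2 ^+ m * t|) `^ (- 1 - alpha))%:E)%E.
    by move=> _; rewrite lee_fin powR_ge0.
  rewrite (@ge0_integralZl_EFin _ mR R mu setT measurableT _ s0 sm _ D0).
  have := @ge0_integral_scale R (2 ^+ m) setT (fun x => ((1 + `|x|) `^ (- 1 - alpha))%:E) c0 measurableT.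
  rewrite preimage_setT => ->; last 2 first.
  - exact/measurable_EFinP.
  - by move=> x _; rewrite lee_fin powR_ge0.
  by rewrite envelope_mass_fin// -!EFinM -mulrA [_ / _]mulrC.
have fM t : cabs (f t) <= D := le_trans (fD t) (eD t).
have L (h : R -> R) : mu.-integrable [set: R] (EFin \o h) -> (forall t, `|h t| <= e t) ->
    \int[mu]_t `|h t| <= D * envelope_mass alpha / 2 ^+ m.
  move=> ih he; rewrite -lee_fin -ie /Rintegral fineK; last first.
    exact: (integrable_fin_num measurableT (integrable_norm ih)).
  apply: ge0_le_integral => //.
  - exact: measurable_int (integrable_norm ih).
  - apply/measurable_EFinP; apply: measurable_funM => //; apply: (measurableT_comp me1); exact: mulrl_measurable.
  - by move=> t _; rewrite lee_fin.
pose B := 4 * (D * envelope_mass alpha / 2 ^+ m).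
have TB n x : cabs (truncated_fourier f n x) <= B.
  have [iP iQ] := integrable_cut n mf fM.
  have [PM QM] := cut_le n fD.
  apply: le_trans (truncated_le x iP iQ) _.
  apply: le_trans (ler_wpM2l _ (lerD (L _ iP PM) (L _ iQ QM))) _ => //.
  by rewrite /B le_eqVlt; apply/orP; left; apply/eqP; ring.
have := fourier_energy_le fH TB mE.
by have -> : 2 * B ^+ 2 = 32 * (D * envelope_mass alpha / 2 ^+ m) ^+ 2 by rewrite /B exprMn; ring.
Qed.

End vaguelet_bound.

(** * Localization forbids concentration *)

Lemma energy_L2norm (R : realType) (f : R -> R[i]) : inL2 f ->
  energy setT f = (L2norm f ^+ 2)%:E.
Proof.
move=> [_ ffin]; rewrite energy_eL2norm /L2norm.
have : (0 <= eL2norm f)%E by exact: Lnorm_ge0.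
case: (eL2norm f) ffin => [r| |]//= _; rewrite lee_fin => r0.
by rewrite powR_mulrn.
Qed.

Lemma energy_realC (R : realType) (D : set R) (u : R -> R) :
  energy D (fun x => (u x)%:C) = (\int[lebesgue_measure]_(x in D) (u x ^+ 2)%:E)%E.
Proof.
by apply: eq_integral => x _; rewrite cabsC real_normK ?num_real.
Qed.

(** Localization bounds the transform of f pointwise by a multiple of
    N / 2 ^ (m / 2), where N is the norm of f, while the lower half of Plancherel's
    identity bounds N by the norm of the transform. Dividing, the share of the energy
    in a set is at most K times its measure with K independent of m: the factor
    2 ^+ m of the dilation cancels. *)
Lemma localized_tilted_energy_spread (R : realType) (gamma C alpha : R)
    (psi : R -> R[i]) (psihat : R -> R) (f g : R -> R[i]) (m : nat) (A : set R) :
  0 < alpha -> 0 <= C -> is_fourier psi (fun x => (psihat x)%:C) ->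
  is_fourier (wavelet_atom psi m 0) g ->
  is_fourier f (fun x => (((h2 gamma x)^-1)%:C)^* * g x) ->
  (forall t, cabs (L2normalize f t) <=
     C * 2 `^ (m%:R / 2) * (1 + `|2 ^+ m * t|) `^ (- 1 - alpha)) ->
  measurable A ->
  (tilted_energy gamma psihat m A <=
   (64 * (C * envelope_mass alpha) ^+ 2 / kappa)%:E * lebesgue_measure A *
   tilted_energy gamma psihat m setT)%E.
Proof.
move=> a0 C0 hpsi hg hf loc mA.
set H := (fun x => _) in hf.
set N := L2norm f; set b : R := 2 `^ (m%:R / 2) in loc *.
have k0 : 0 < kappa :> R by exact: kappa_gt0.
have b0 : 0 < b by rewrite powR_gt0.
have c0 : 0 < (2 : R) ^+ m by rewrite exprn_gt0.
have c'0 : 0 < (2 ^+ m : R)^-1 by rewrite invr_gt0.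
have bc : b ^+ 2 = 2 ^+ m by exact: sqr_powR2_half.
have [Lf _ _] := hf; have [mf _] := Lf.
have fN := energy_L2norm Lf; rewrite -/N in fN.
have N0 : 0 <= N by rewrite /N fine_ge0// Lnorm_ge0.
set E : set R := *%R (2 ^- m) @^-1` A.
have mE : measurable E.
  rewrite -[X in measurable X]setTI.
  have mc : measurable_fun [set: R] ( *%R (2 ^- m)) by exact: mulrl_measurable.
  exact: mc.
have muE : lebesgue_measure E = ((2 ^+ m)%:E * lebesgue_measure A)%E.
  by have := lebesgue_measure_scale c'0 mA; rewrite /pushforward invrK.
have tA : tilted_energy gamma psihat m A = energy E H by rewrite (energy_dilate _ hpsi hg).
have tT : tilted_energy gamma psihat m setT = energy setT H.
  by rewrite -(energy_dilate _ hpsi hg)// preimage_setT.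
rewrite tA tT.
have W0 : 0 <= envelope_mass alpha :> R by apply: Rintegral_ge0 => x _; exact: powR_ge0.
have K0 : 0 <= 64 * (C * envelope_mass alpha) ^+ 2 / kappa.
  by rewrite divr_ge0 ?(ltW k0)// mulr_ge0// sqr_ge0.
have [N_eq0|N_neq0] := eqVneq N 0.
  have f0 : energy setT f = 0%E by rewrite fN N_eq0 expr0n.
  have := fourier_energy_le hf (fun n x => truncated_null n x mf f0) mE.
  rewrite expr0n/= mulr0 mul0e => /le_trans; apply.
  by rewrite !mule_ge0 ?lee_fin ?energy_ge0.
have Ngt0 : 0 < N by rewrite lt_neqAle eq_sym N_neq0.
have fD t : cabs (f t) <= N * C * b * (1 + `|2 ^+ m * t|) `^ (- 1 - alpha).
  have := loc t; rewrite /L2normalize -/N cabsM cabsC ger0_norm ?invr_ge0//.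
  by rewrite mulrC ler_pdivrMr// => /le_trans; apply; rewrite mulrC !mulrA.
have D0 : 0 <= N * C * b by rewrite !mulr_ge0// ltW.
have up := localized_energy_spread a0 D0 hf mE fD.
have lo : ((kappa * N ^+ 2)%:E <= 2%:E * energy setT H)%E.
  rewrite EFinM -fN; apply: (fourier_energy_ge hf (M := N * C * b)) => t.
  by apply: (le_trans (fD t)); rewrite ler_piMr// envelope_le1// ltW.
apply: (le_trans up); rewrite muE.
apply: (@le_trans _ _ ((64 * (C * envelope_mass alpha) ^+ 2 / kappa)%:E *
    lebesgue_measure A * (kappa * N ^+ 2 / 2)%:E)%E); last first.
  rewrite lee_wpmul2l ?mule_ge0 ?lee_fin//.
  by rewrite -(@lee_pmul2l _ 2%:E)// -EFinM mulrC divfK.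
rewrite muleAC muleA -!EFinM le_eqVlt; apply/orP; left; apply/eqP; congr (_%:E * _)%E.
rewrite -bc; field.
by rewrite !gt_eqF.
Qed.

(** * Failure of localization *)

Unset Implicit Arguments.
Set Strict Implicit.
Set Printing Implicit Defensive.

Theorem mainTheorem3 (R : realType) (gamma a : R) (r : nat)
    (psi : R -> R[i]) (psihat : R -> R) (Psis : int -> int -> R -> R[i])
    (gamma_gt0 : 0 < gamma) (a_gt0 : 0 < a) (r_gt0 : (0 < r)%N)
    (psi_wavelet : is_wavelet psi)
    (psihatE : is_fourier psi (fun x => (psihat x)%:C))
    (psihat_even : forall x, psihat x = psihat (- x))
    (psihat_supp : closure [set x | psihat x != 0] `<=` `[- a, a])
    (psihat_C : class_C r.-1 psihat)
    (psihat_a : forall m, (m < r)%N -> derive1n m psihat a = 0)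
    (psihat_ra : exists2 l, is_left_derive r psihat a l & l != 0)
    (PsisE : forall j k : int, 0 <= j ->
       exists2 g : R -> R[i],
         is_fourier (wavelet_atom psi j k) g &
         is_fourier (Psis j k)
           (fun x => ((((h2 gamma x)^-1)%:C)^*) * g x)) :
  let J := [set j : int | 0 <= j] in
  let Psi := fun j k => L2normalize (Psis j k) in
  ~ (exists C alpha1 : R,
       [/\ 0 < C, 0 < alpha1, alpha1 < 1 & localized J Psi C alpha1]) /\
  ~ vaguelets J Psi.
Proof.
move=> J Psi.
have main : ~ (exists C alpha1 : R,
    [/\ 0 < C, 0 < alpha1, alpha1 < 1 & localized J Psi C alpha1]).
  move=> [C [alpha [C0 a0 _ loc]]].
  have [_ Lpsihat _] := psihatE.
  have mpsihat : measurable_fun [set: R] psihat by case: Lpsihat => -[].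
  have cpsihat : continuous psihat by exact: (psihat_C.2 0%N).
  have [l hl l0] := psihat_ra.
  apply: (@no_spreading R gamma a psihat gamma_gt0 a_gt0 mpsihat
    (64 * (C * envelope_mass alpha) ^+ 2 / kappa)).
  - move=> x ax; apply: contrapT => /eqP px.
    have /psihat_supp : closure [set x | psihat x != 0] x by exact: subset_closure.
    by rewrite /= in_itv/= -ler_norml leNgt ax.
  - by rewrite -energy_realC energy_L2norm// ltry.
  - move=> e e0.
    have ra : (r.-1 < r)%N by rewrite prednK.
    have [y yae py] := nonzero_near_edge (psihat_a _ ra) hl l0 e0.
    exact: (integral_sqr_gt0 cpsihat yae py).
  - by rewrite divr_ge0 ?(ltW (kappa_gt0))// mulr_ge0// sqr_ge0.
  - move=> m; have [g hg hf] := PsisE m 0 isT.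
    have -> : tilted_energy gamma psihat m setT =
        energy setT (fun x => (((h2 gamma x)^-1)%:C)^* * g x).
      by rewrite -(energy_dilate gamma psihatE hg)// preimage_setT.
    by have [_ LH _] := hf; rewrite energy_L2norm// ltry.
  - move=> m A mA; have [g hg hf] := PsisE m 0 isT.
    apply: (localized_tilted_energy_spread a0 (ltW C0) psihatE hg hf) => // t.
    by have := loc m 0 t isT; rewrite subr0.
(* the constant of a vaguelet family carries no sign, hence the maximum with 1 *)
split=> // -[C [alpha1 [alpha2 [[h1 h2 h3] loc _ _]]]].
apply: main; exists (Num.max C 1), alpha1; split => //.
- by rewrite lt_max ltr01 orbT.
- exact: lt_trans h1 h2.
- move=> j k t Jj; apply: (le_trans (loc j k t Jj)).
  by rewrite ler_wpM2r ?powR_ge0// ler_wpM2r ?powR_ge0// le_max lexx.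
Qed.
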